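(* Let $\mathcal N\in\mathcal C(\mathcal H_A\otimes\mathcal H_J,\mathcal H_B)$. Then either $\overline{\mathcal A}_{d,CET}(\mathcal N)=\{(0,0)\}$ or $\overline{\mathcal A}_{d,CET}(\mathcal N)=\overline{\mathcal A}_{r,CET}(\mathcal N)$.
   Context: Finite-dimensional Hilbert spaces; $F(\rho,\sigma)=\|\sqrt\rho\sqrt\sigma\|_1^2$. For $\sigma\in\mathcal S(\mathcal H_J^{\otimes n})$, $\mathcal N_{n,\sigma}(\cdot):=\mathcal N^{\otimes n}(\cdot\otimes\sigma)$. An $(n,M_1,M_2)$ CET code $\mathcal C=(\mathcal P_m,\mathcal R_m)_{m=1}^{M_1}$: $\mathcal F_A\subset\mathcal F_B$, $\dim\mathcal F_A=M_2$, $\mathcal P_m$ CPTP $\mathcal L(\mathcal F_A)\to\mathcal L(\mathcal H_A^{\otimes n})$, $\mathcal R_m$ CP trace non-increasing $\mathcal L(\mathcal H_B^{\otimes n})\to\mathcal L(\mathcal F_B)$, $\sum_m\mathcal R_m$ trace preserving; $\mathcal R=\sum_m|m\rangle\langle m|\otimes\mathcal R_m$; $\overline P_{CET}(\mathcal C,\mathcal M)=\frac1{M_1}\sum_mF(|m\rangle\langle m|\otimes\Phi,(\mathrm{id}\otimes\mathcal R\circ\mathcal M\circ\mathcal P_m)(\Phi))$, $\Phi$ maximally entangled on $\mathcal F_A\otimes\mathcal F_A$. A random code is a probability measure $\mu_n$ on codes. $\overline{\mathcal A}_{r,CET}(\mathcal N)$ (resp. $\overline{\mathcal A}_{d,CET}(\mathcal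 N)$) is the set of $(R_1,R_2)\ge0$ for which there are random codes $\mu_n$ (resp. deterministic codes $\mathcal C_n$) with $\liminf_n\frac1n\log M_{i,n}\ge R_i$ and $\lim_n\inf_{\sigma\in\mathcal S(\mathcal H_J^{\otimes n})}\int\overline P_{CET}(\cdot,\mathcal N_{n,\sigma})d\mu_n=1$ (resp. $\lim_n\inf_\sigma\overline P_{CET}(\mathcal C_n,\mathcal N_{n,\sigma})=1$). *)

(* Defs.v *)
From HB Require Import structures.
From mathcomp Require Import all_boot all_order all_algebra.
From mathcomp Require Import complex.
From mathcomp Require Import all_classical all_reals all_analysis.
From mathcomp Require Import Rstruct Rstruct_topology.
From Stdlib Require Import ClassicalEpsilon.
Set Implicit Arguments. Unset Strict Implicit. Unset Printing Implicit Defensive.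
Import Order.TTheory GRing.Theory Num.Theory.
Local Open Scope ring_scope.
Local Open Scope classical_set_scope.

Notation RR := Rdefinitions.R.
Notation CC := (Rdefinitions.R[i]).

(* Operators on the Hilbert space C^I whose orthonormal basis is indexed by
   the finite type I (matrices indexed via enum_rank). *)
Definition op (I : finType) := 'M[CC]_#|I|.
Definition opE {I : finType} (A : op I) (i j : I) : CC :=
  A (enum_rank i) (enum_rank j).
Definition mkop {I : finType} (f : I -> I -> CC) : op I :=
  \matrix_(p, q) f (enum_val p) (enum_val q).

Definition adjm {m n : nat} (A : 'M[CC]_(m, n)) : 'M[CC]_(n, m) :=
  \matrix_(i, j) conjc (A j i).

Definition psd {n : nat} (A : 'M[CC]_n) : Prop :=
  forall v : 'cV[CC]_n, 0 <= (adjm v *m A *m v) 0 0.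

Definition msqrt {n : nat} (A : 'M[CC]_n) : 'M[CC]_n :=
  epsilon (inhabits 0) (fun B => psd B /\ B *m B = A).

Definition tnorm {n : nat} (X : 'M[CC]_n) : CC := \tr (msqrt (adjm X *m X)).

Definition fid {n : nat} (rho sigma : 'M[CC]_n) : RR :=
  (complex.Re (tnorm (msqrt rho *m msqrt sigma))) ^+ 2.

Definition density {I : finType} (rho : op I) : Prop := psd rho /\ \tr rho = 1.

Definition lmap (I J : finType) := op I -> op J.

Definition is_lin {I J : finType} (Phi : lmap I J) : Prop :=
  forall (a : CC) (X Y : op I), Phi (a *: X + Y) = a *: Phi X + Phi Y.

(* id_k (x) Phi, acting on L(C^k (x) C^I) *)
Definition idt (k : nat) {I J : finType} (Phi : lmap I J) :
  lmap ('I_k * I)%type ('I_k * J)%type :=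
  fun X => mkop (fun p q : ('I_k * J)%type =>
    opE (Phi (mkop (fun i j => opE X (p.1, i) (q.1, j)))) p.2 q.2).
Arguments idt k {I J} Phi.

Definition CP {I J : finType} (Phi : lmap I J) : Prop :=
  forall (k : nat) (X : op ('I_k * I)%type), psd X -> psd (idt k Phi X).
Definition TP {I J : finType} (Phi : lmap I J) : Prop :=
  forall X : op I, \tr (Phi X) = \tr X.
Definition TNI {I J : finType} (Phi : lmap I J) : Prop :=
  forall X : op I, psd X -> \tr (Phi X) <= \tr X.

Definition channel {I J : finType} (Phi : lmap I J) : Prop :=
  [/\ is_lin Phi, CP Phi & TP Phi].

Definition eunit {I : finType} (a b : I) : op I :=
  mkop (fun p q => ((p == a) && (q == b))%:R).

(* n-fold tensor power of a linear map; the basis of H^{(x) n} is indexed by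
   {ffun 'I_n -> I}.  Defined on matrix units and extended linearly. *)
Definition tpow (n : nat) {I J : finType} (Phi : lmap I J) :
  lmap {ffun 'I_n -> I} {ffun 'I_n -> J} :=
  fun X => \sum_(i : {ffun 'I_n -> I}) \sum_(j : {ffun 'I_n -> I})
    opE X i j *: mkop (fun p q : {ffun 'I_n -> J} =>
      \prod_(k < n) opE (Phi (eunit (i k) (j k))) (p k) (q k)).
Arguments tpow n {I J} Phi.

(* N_{n,sigma}(rho) = N^{(x) n}(rho (x) sigma), identifying
   H_A^{(x) n} (x) H_J^{(x) n} with (H_A (x) H_J)^{(x) n}. *)
Definition Nns {dA dJ dB : nat} (N : lmap ('I_dA * 'I_dJ)%type 'I_dB) (n : nat)
  (sigma : op {ffun 'I_n -> 'I_dJ}) :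
  lmap {ffun 'I_n -> 'I_dA} {ffun 'I_n -> 'I_dB} :=
  fun rho => tpow n N (mkop (fun p q : {ffun 'I_n -> 'I_dA * 'I_dJ} =>
     opE rho [ffun k => (p k).1] [ffun k => (q k).1] *
     opE sigma [ffun k => (p k).2] [ffun k => (q k).2])).

(* (n, M1, M2) CET codes.  F_B = C^('I_M2 + 'I_cext), with F_A = C^('I_M2)
   embedded as the span of the inl basis vectors. *)
Record code (dA dB n M1 M2 : nat) := Code {
  cext : nat;
  cenc : 'I_M1 -> lmap 'I_M2 {ffun 'I_n -> 'I_dA};
  cdec : 'I_M1 -> lmap {ffun 'I_n -> 'I_dB} ('I_M2 + 'I_cext)%type }.

Definition is_code {dA dB n M1 M2 : nat} (C : code dA dB n M1 M2) : Prop :=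
  [/\ (0 < M1)%N, (0 < M2)%N,
      (forall m, channel (cenc C m)),
      (forall m, [/\ is_lin (cdec C m), CP (cdec C m) & TNI (cdec C m)]) &
      TP (fun X => \sum_(m < M1) cdec C m X)].

(* R = sum_m |m><m| (x) R_m *)
Definition cdecR {dA dB n M1 M2 : nat} (C : code dA dB n M1 M2) :
  lmap {ffun 'I_n -> 'I_dB} ('I_M1 * ('I_M2 + 'I_(cext C)))%type :=
  fun Y => mkop (fun p q : ('I_M1 * ('I_M2 + 'I_(cext C)))%type =>
    if p.1 == q.1 then opE (cdec C p.1 Y) p.2 q.2 else 0).

Definition maxent (M2 : nat) : op ('I_M2 * 'I_M2)%type :=
  mkop (fun p q : ('I_M2 * 'I_M2)%type => ((p.1 == p.2) && (q.1 == q.2))%:R / M2%:R).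

(* |m><m| (x) Phi, as an operator on F_A (x) (C^M1 (x) F_B) *)
Definition cet_target {M1 M2 e : nat} (m : 'I_M1) :
  op ('I_M2 * ('I_M1 * ('I_M2 + 'I_e)))%type :=
  mkop (fun p q : ('I_M2 * ('I_M1 * ('I_M2 + 'I_e)))%type =>
    if (p.2.1 == m) && (q.2.1 == m) then
      match p.2.2, q.2.2 with
      | inl c, inl c' => ((p.1 == c) && (q.1 == c'))%:R / M2%:R
      | _, _ => 0
      end
    else 0).

Definition PCET {dA dB n M1 M2 : nat} (C : code dA dB n M1 M2)
  (M : lmap {ffun 'I_n -> 'I_dA} {ffun 'I_n -> 'I_dB}) : RR :=
  (M1%:R)^-1 * \sum_(m < M1)
    fid (cet_target (e := cext C) m)
        (idt M2 (fun X => cdecR C (M (cenc C m X))) (maxent M2)).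

Definition rate_ge (M : nat -> nat) (r : RR) : Prop :=
  (r%:E <= limn_einf (fun n => (ln (M n)%:R / (n%:R * ln 2))%:E))%E.

Definition Ad_CET {dA dJ dB : nat} (N : lmap ('I_dA * 'I_dJ)%type 'I_dB) :
  set (RR * RR) :=
  [set r : RR * RR | [/\ 0 <= r.1, 0 <= r.2 &
    exists (M1 M2 : nat -> nat) (C : forall n, code dA dB n (M1 n) (M2 n)),
      [/\ forall n, is_code (C n), rate_ge M1 r.1, rate_ge M2 r.2 &
        (fun n => ereal_inf [set (PCET (C n) (Nns N sigma))%:E
                             | sigma in [set s | density s]])
          @ \oo --> 1%E]]].

(* random-code achievable region \bar A_{r,CET}(N): a random (n,M1,M2) code
   is given as a probability space (Omega_n, P_n) together with a
   code-valued map omega |-> C_n(omega) (mu_n is its law). *)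
Definition Ar_CET {dA dJ dB : nat} (N : lmap ('I_dA * 'I_dJ)%type 'I_dB) :
  set (RR * RR) :=
  [set r : RR * RR | [/\ 0 <= r.1, 0 <= r.2 &
    exists (M1 M2 : nat -> nat) (d : nat -> measure_display)
           (Omega : forall n, measurableType (d n))
           (P : forall n, probability (Omega n) RR)
           (C : forall n, Omega n -> code dA dB n (M1 n) (M2 n)),
      [/\ forall n w, is_code (C n w),
          forall n (sigma : op {ffun 'I_n -> 'I_dJ}), density sigma ->
            @measurable_fun _ _ (Omega n) (Real.sort RR) [set: Omega n]
              (fun w => PCET (C n w) (Nns N sigma)),
          rate_ge M1 r.1, rate_ge M2 r.2 &
        (fun n => ereal_inf
            [set (\int[P n]_w (PCET (C n w) (Nns N sigma))%:E)%E
             | sigma in [set s | density s]])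
          @ \oo --> 1%E]]].

(* Main.v *)
(* For a pure target the fidelity is linear, so the success of a code is a
   positive linear functional [succ] of the jammer state, bounded by the trace.
   A random code that is good on average contains, for every jammer state, a
   good deterministic code.  From this, codes [C_1 .. C_K] are selected greedily
   whose uniform mixture is good against all jammer states at once: with [Z_i]
   the operator of the failure functional of [C_i] and [S] the sum of [u 1] and
   the [Z_i] chosen so far, the potential [tr S^p] grows by a factor of at most
   [1 + 2 p eps / u] per step, where [p] is a power of two of the order of the
   block length.  The step estimate rests on the Lieb-Thirring inequality, which
   for such exponents is repeated Cauchy-Schwarz.  A deterministic code of
   positive rate and negligible length (about the square root of the block
   length) sends the index of the code that is used next; its number of messages
   [M1 * M2] grows faster than the block length, and exactly that many codes
   [C_i] are selected. *)
Require Import Defs.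
From HB Require Import structures.
From mathcomp Require Import all_boot all_order all_algebra.
From mathcomp Require Import complex.
From mathcomp Require Import all_classical all_reals all_analysis.
From mathcomp Require Import Rstruct Rstruct_topology.
From mathcomp Require Import ring zify.
From Stdlib Require Import ClassicalEpsilon.
From Stdlib Require PeanoNat.
Set Implicit Arguments. Unset Strict Implicit. Unset Printing Implicit Defensive.
(* [Defs] is imported again because [all_analysis] hides [Defs.code]. *)
Import Order.TTheory GRing.Theory Num.Theory numFieldNormedType.Exports Defs.
Local Open Scope ring_scope.
Local Open Scope classical_set_scope.

(** * Positive semidefinite matrices *)

(** The error of the random code may vanish arbitrarily slowly, and the jammer acts on a space of
    dimension [dJ ^ n], possibly entangled over the whole block. The potential absorbs both. After a
    [p]-th root with [p >= n] the dimension costs only a factor [dJ], and the growth over [K] steps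
    costs a factor e once [2 eps K <= u]. The failures of all [K] codes thus add up to at most
    [e * dJ * u], where [u] only has to dominate [4 n] and [2 eps K]; dividing by [K] leaves a
    vanishing mean failure because [K] outgrows [n]. Entanglement between prefix and remainder is
    harmless: a decoding outcome on the prefix turns the jammer state of the remainder into an
    unnormalised conditional state, and positivity of the success functionals makes the two failure
    probabilities add. Either positive rate yields enough indices, since the prefix code is used
    classically on the basis messages [(m, a)], whose average success probability dominates its
    entanglement fidelity. *)

Lemma conjcD (x y : CC) : conjc (x + y) = conjc x + conjc y.
Proof. exact: rmorphD. Qed.

Lemma conjcM (x y : CC) : conjc (x * y) = conjc x * conjc y.
Proof. exact: rmorphM. Qed.

Lemma conjc_natr k : conjc (k%:R : CC) = k%:R.
Proof. exact: rmorph_nat. Qed.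

Lemma conjc_sum (I : Type) (r : seq I) (P : pred I) (F : I -> CC) :
  conjc (\sum_(i <- r | P i) F i) = \sum_(i <- r | P i) conjc (F i).
Proof. exact: rmorph_sum. Qed.

Lemma conjc_prod (I : Type) (r : seq I) (P : pred I) (F : I -> CC) :
  conjc (\prod_(i <- r | P i) F i) = \prod_(i <- r | P i) conjc (F i).
Proof. exact: rmorph_prod. Qed.

Lemma adjmK m n (A : 'M[CC]_(m, n)) : adjm (adjm A) = A.
Proof. by apply/matrixP => i j; rewrite !mxE conjcK. Qed.

Lemma adjmM m n p (A : 'M[CC]_(m, n)) (B : 'M[CC]_(n, p)) :
  adjm (A *m B) = adjm B *m adjm A.
Proof.
apply/matrixP => i j; rewrite !mxE rmorph_sum.
by apply: eq_bigr => k _; rewrite !mxE rmorphM mulrC.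
Qed.

Lemma adjmD m n (A B : 'M[CC]_(m, n)) : adjm (A + B) = adjm A + adjm B.
Proof. by apply/matrixP => i j; rewrite !mxE rmorphD. Qed.

Lemma adjmZ m n a (A : 'M[CC]_(m, n)) : adjm (a *: A) = conjc a *: adjm A.
Proof. by apply/matrixP => i j; rewrite !mxE rmorphM. Qed.

Lemma adjm1 n : adjm (1%:M : 'M[CC]_n) = 1%:M.
Proof. by apply/matrixP => i j; rewrite !mxE eq_sym rmorph_nat. Qed.

Lemma conjc_ge0 (x : CC) : 0 <= x -> conjc x = x.
Proof. by move=> x0; apply/(@CrealP CC)/ger0_real. Qed.

Lemma mul_conjc_ge0 (x : CC) : 0 <= x * conjc x.
Proof. exact: (@mul_conjC_ge0 CC). Qed.

Lemma mul_conjc_normE (x : CC) : x * conjc x = `|x| ^+ 2.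
Proof. exact: (esym (@normCK CC x)). Qed.

Lemma cV_adj_mul_ge0 n (v : 'cV[CC]_n) : 0 <= (adjm v *m v) 0 0.
Proof.
by rewrite mxE sumr_ge0 // => i _; rewrite mxE mulrC mul_conjc_ge0.
Qed.

Lemma psdD n (A B : 'M[CC]_n) : psd A -> psd B -> psd (A + B).
Proof.
by move=> pA pB v; rewrite mulmxDr mulmxDl mxE addr_ge0 ?pA ?pB.
Qed.

Lemma psd0 n : psd (0 : 'M[CC]_n).
Proof. by move=> v; rewrite mulmx0 mul0mx mxE. Qed.

Lemma psdZ n a (A : 'M[CC]_n) : 0 <= a -> psd A -> psd (a *: A).
Proof.
by move=> a0 pA v; rewrite -scalemxAr -scalemxAl mxE mulr_ge0 ?pA.
Qed.

Lemma psd_sum n (I : Type) (r : seq I) (P : pred I) (F : I -> 'M[CC]_n) :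
  (forall i, P i -> psd (F i)) -> psd (\sum_(i <- r | P i) F i).
Proof. by move=> h; apply: big_ind => //; [exact: psd0|exact: psdD]. Qed.

Lemma psd_congr m n (A : 'M[CC]_n) (B : 'M[CC]_(n, m)) :
  psd A -> psd (adjm B *m A *m B).
Proof. by move=> pA v; have := pA (B *m v); rewrite adjmM !mulmxA. Qed.

Lemma psd1 n : psd (1%:M : 'M[CC]_n).
Proof. by move=> v; rewrite mulmx1 cV_adj_mul_ge0. Qed.

Lemma psd_scalar n (a : CC) : 0 <= a -> psd (a%:M : 'M[CC]_n).
Proof. by move=> a0; rewrite -scalemx1; apply: psdZ => //; apply: psd1. Qed.

Lemma psd_gram m n (G : 'M[CC]_(n, m)) : psd (G *m adjm G).
Proof.
by have := psd_congr (adjm G) (@psd1 m); rewrite adjmK mulmx1.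
Qed.

(* Polarisation: the quadratic form at [e_i + e_j] and [e_i + 'i e_j]. *)
Lemma psd_herm n (A : 'M[CC]_n) : psd A -> adjm A = A.
Proof.
move=> pA.
have qf (c : CC) i j : (adjm (delta_mx i 0 + c *: delta_mx j 0 : 'cV[CC]_n) *m A *m
     (delta_mx i 0 + c *: delta_mx j 0 : 'cV[CC]_n)) 0 0
   = A i i + c * A i j + conjc c * A j i + conjc c * c * A j j.
  have ad k : adjm (delta_mx k 0 : 'cV[CC]_n) = delta_mx 0 k.
    by apply/matrixP => x y; rewrite !mxE andbC conjc_natr.
  have e x y : ((delta_mx 0 x : 'rV[CC]_n) *m A *m (delta_mx y 0 : 'cV[CC]_n)) 0 0 = A x y.
    by rewrite -rowE -colE !mxE.
  rewrite adjmD adjmZ !ad !mulmxDl !mulmxDr -!scalemxAl -!scalemxAr.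
  have aE (X Y : 'M[CC]_1) : (X + Y) 0 0 = X 0 0 + Y 0 0 by rewrite mxE.
  have sE a (X : 'M[CC]_1) : (a *: X) 0 0 = a * X 0 0 by rewrite mxE.
  by rewrite !aE !sE !e !addrA !mulrA.
have rl (c : CC) i j : conjc (A i i + c * A i j + conjc c * A j i + conjc c * c * A j j)
   = A i i + c * A i j + conjc c * A j i + conjc c * c * A j j.
  by rewrite -qf conjc_ge0.
have dg i : conjc (A i i) = A i i.
  by have := rl 0 i i; rewrite conjc0 !mul0r !addr0.
apply/matrixP => i j; rewrite mxE.
have h1 := rl 1 i j; have h2 := rl 'i%C i j.
rewrite conjc1 !mul1r !conjcD !dg in h1.
have ci : conjc 'i%C = - 'i%C :> CC by apply/eqP; rewrite eq_complex /= ?oppr0 !eqxx.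
have ii : 'i%C * 'i%C = -1 :> CC by rewrite -expr2 complex.sqr_i.
rewrite !conjcD !conjcM !conjcK !ci !dg in h2.
have h1' : conjc (A i j) + conjc (A j i) = A i j + A j i.
  apply: (addrI (A i i)); apply: (addIr (A j j)).
  by rewrite !addrA.
have h2' : - conjc (A i j) + conjc (A j i) = A i j - A j i.
  have i0 : 'i%C != 0 :> CC by rewrite eq_complex /= oner_eq0 andbF.
  apply: (mulfI i0); apply/subr0_eq; move/eqP: h2; rewrite -subr_eq0 => /eqP.
  by apply: etrans; ring.
apply: (mulfI (_ : 2%:R != 0 :> CC)); first by rewrite pnatr_eq0.
have -> : 2%:R * A i j = (A i j + A j i) + (A i j - A j i) by ring.
rewrite -h1' -h2'; move: (conjc (A i j)) (conjc (A j i)) => x y.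
by ring.
Qed.

(** Spectral form: sums, products and powers of matrices that share the eigenbasis [U] become
    entrywise operations on [d]. *)
Definition sdiag n (U : 'M[CC]_n) (d : 'rV[CC]_n) : 'M[CC]_n :=
  U *m diag_mx d *m adjm U.

Lemma psd_spectral n (A : 'M[CC]_n) : psd A ->
  exists (U : 'M[CC]_n) (d : 'rV[CC]_n), [/\ U *m adjm U = 1%:M, adjm U *m U = 1%:M,
    (forall i, 0 <= d 0 i) & A = sdiag U d].
Proof.
move=> pA; have hA := psd_herm pA.
have adjE (B : 'M[CC]_n) : adjm B = (map_mx Num.conj B^T).
  by apply/matrixP => i j; rewrite !mxE.
have /orthomx_spectralP AE : A \is @normalmx CC n.
  by apply/normalmxP; rewrite -adjE hA.
have Pu := spectral_unitarymx A.
have iP : invmx (spectralmx A) = adjm (spectralmx A).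
  by rewrite (invmx_unitary Pu) adjE.
have PP : spectralmx A *m adjm (spectralmx A) = 1%:M.
  by move/unitarymxP: Pu; rewrite -adjE.
exists (adjm (spectralmx A)), (spectral_diag A).
rewrite adjmK; split => //; first by rewrite mulmx1C.
- move=> i; have := pA (adjm (spectralmx A) *m delta_mx i 0).
  rewrite {2}AE iP adjmM adjmK -!mulmxA (mulmxA (spectralmx A)) PP mul1mx.
  rewrite (mulmxA (spectralmx A) _ (delta_mx _ _)) PP mul1mx.
  have -> : adjm (delta_mx i 0 : 'cV[CC]_n) = delta_mx 0 i.
    by apply/matrixP => x y; rewrite !mxE andbC conjc_natr.
  by rewrite -colE -rowE !mxE eqxx mulr1n.
- by rewrite /sdiag adjmK {1}AE iP.
Qed.

Section sdiag.
Variables (n : nat) (U : 'M[CC]_n).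
Hypotheses (UU : adjm U *m U = 1%:M) (UU' : U *m adjm U = 1%:M).

Lemma sdiagM d e : sdiag U d *m sdiag U e = sdiag U (\row_i (d 0 i * e 0 i)).
Proof.
rewrite /sdiag -!mulmxA (mulmxA (adjm U)) UU mul1mx (mulmxA (diag_mx d)).
by rewrite mulmx_diag.
Qed.

Lemma sdiagD d e : sdiag U d + sdiag U e = sdiag U (d + e).
Proof. by rewrite /sdiag raddfD /= mulmxDr mulmxDl. Qed.

Lemma sdiagZ a d : a *: sdiag U d = sdiag U (a *: d).
Proof. by rewrite /sdiag linearZ /= -scalemxAr -scalemxAl. Qed.

Lemma sdiag_const a : sdiag U (const_mx a) = a%:M.
Proof. by rewrite /sdiag diag_const_mx mul_mx_scalar -scalemxAl UU' scalemx1. Qed.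

Lemma sdiagX d k : sdiag U d ^+ k = sdiag U (\row_i (d 0 i ^+ k)).
Proof.
elim: k => [|k IH].
  rewrite expr0 -[LHS]/(1%:M) -(sdiag_const 1); congr sdiag.
  by apply/rowP => i; rewrite !mxE.
rewrite exprS IH; apply: etrans (sdiagM _ _) _; congr sdiag.
by apply/rowP => i; rewrite !mxE exprS.
Qed.

Lemma psd_sdiag (d : 'rV[CC]_n) : (forall i, 0 <= d 0 i) <-> psd (sdiag U d).
Proof.
split=> [d0|pd i].
- rewrite /sdiag -{1}[U]adjmK; apply: psd_congr => v.
  rewrite mxE sumr_ge0 // => i _.
  by rewrite mul_mx_diag !mxE mulrAC mulr_ge0 // mulrC mul_conjc_ge0.
have := pd (U *m delta_mx i 0).
rewrite /sdiag adjmM -!mulmxA (mulmxA (adjm U) U) UU mul1mx.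
rewrite (mulmxA (adjm U) U) UU mul1mx.
have -> : adjm (delta_mx i 0 : 'cV[CC]_n) = delta_mx 0 i.
  by apply/matrixP => x y; rewrite !mxE andbC conjc_natr.
by rewrite -colE -rowE !mxE eqxx mulr1n.
Qed.

Lemma tr_sdiag d : \tr (sdiag U d) = \sum_i d 0 i.
Proof. by rewrite /sdiag mxtrace_mulC mulmxA UU mul1mx mxtrace_diag. Qed.
End sdiag.

Lemma psd_sqrt n (A : 'M[CC]_n) : psd A -> exists B, psd B /\ B *m B = A.
Proof.
move=> /psd_spectral[U [d [UU' UU d0 ->]]].
exists (sdiag U (\row_i sqrtC (d 0 i))); split.
  by apply/psd_sdiag => // i; rewrite mxE sqrtC_ge0.
rewrite sdiagM //; congr sdiag; apply/rowP => i.
by rewrite !mxE -expr2 sqrtCK.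
Qed.

(** [A] and [B] are the square roots of [S] and of its inverse, which exists because the spectrum
    lies above [u > 0]. They serve to pull [S] out of a sum [S + Z]. *)
Lemma psd_ge_sqrt_inv n (S : 'M[CC]_n) (u : CC) : 0 < u -> psd (S - u%:M) ->
  exists A B : 'M[CC]_n, [/\ psd A, psd B, A *m A = S & A *m B = 1%:M].
Proof.
move=> u0 pS.
have pS0 : psd S.
  by rewrite -[S](subrK u%:M); apply: psdD => //; apply/psd_scalar/ltW.
move/psd_spectral: pS0 => [U [d [UU' UU d0 SE]]].
have du i : u <= d 0 i.
  rewrite -subr_ge0; move: pS; rewrite SE -(sdiag_const UU') -[sdiag U (const_mx u)]opprK.
  rewrite opprK -scaleN1r sdiagZ sdiagD => /(psd_sdiag UU) /(_ i).
  by rewrite !mxE mulN1r.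
exists (sdiag U (\row_i sqrtC (d 0 i))), (sdiag U (\row_i (sqrtC (d 0 i))^-1)); split.
- by apply/psd_sdiag => // i; rewrite mxE sqrtC_ge0.
- by apply/psd_sdiag => // i; rewrite mxE invr_ge0 sqrtC_ge0.
- rewrite sdiagM // SE; congr sdiag; apply/rowP => i.
  by rewrite !mxE -expr2 sqrtCK.
rewrite sdiagM // -(sdiag_const UU'); congr sdiag; apply/rowP => i.
by rewrite !mxE mulfV // sqrtC_eq0 gt_eqF // (lt_le_trans u0).
Qed.

Lemma psd_exp n (A : 'M[CC]_n) k : psd A -> psd (A ^+ k).
Proof.
move=> /psd_sqrt[B [pB <-]].
have -> : (B *m B) ^+ k = B ^+ k *m adjm (B ^+ k).
  have -> : adjm (B ^+ k) = B ^+ k.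
    elim: k => [|k IH]; first by rewrite expr0 adjm1.
    by rewrite [in LHS]exprSr [X in adjm X]/(_ *m _) adjmM IH (psd_herm pB) exprS.
  by rewrite -[B *m B]/(B * B) exprMn_comm.
exact: psd_gram.
Qed.

Lemma tr_psd_ge0 n (A : 'M[CC]_n) : psd A -> 0 <= \tr A.
Proof.
by move=> /psd_spectral[U [d [UU' UU d0 ->]]]; rewrite tr_sdiag // sumr_ge0.
Qed.

Lemma tr_mul_psd_ge0 n (A B : 'M[CC]_n) : psd A -> psd B -> 0 <= \tr (A *m B).
Proof.
move=> /psd_sqrt[C [pC <-]] pB.
rewrite -mulmxA mxtrace_mulC -{1}(psd_herm pC).
by apply/tr_psd_ge0/psd_congr.
Qed.

(** On eigenvalues this is [(1 + y)^p <= 1 + 2 p y] for [0 <= 2 p y <= 1]. In the induction the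
    cross term [(2 j y) y] is at most [y], and the slope 2 leaves room for it. *)
Lemma psd_onem_pow n (Y : 'M[CC]_n) (p : nat) : psd Y ->
  psd (1%:M - (2 * p)%:R *: Y) ->
  psd (1%:M + (2 * p)%:R *: Y - (1%:M + Y) ^+ p).
Proof.
move=> /psd_spectral[U [d [UU' UU d0 ->]]].
have [c cE] : exists c : CC, c = (2 * p)%:R by exists (2 * p)%:R.
rewrite -cE.
have -> : 1%:M - c *: sdiag U d = sdiag U (const_mx 1 + (-1) *: (c *: d)).
  by rewrite -sdiagD -!sdiagZ sdiag_const // scaleN1r.
have -> : 1%:M + sdiag U d = sdiag U (const_mx 1 + d).
  by rewrite -sdiagD sdiag_const.
rewrite sdiagX // => /(psd_sdiag UU) d1.
have -> x : 1%:M + c *: sdiag U d - sdiag U x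
    = sdiag U (const_mx 1 + c *: d + (-1) *: x).
  by rewrite -!sdiagD -!sdiagZ sdiag_const // scaleN1r.
apply/(psd_sdiag UU) => i; move: d1; rewrite {c}cE => d1.
have := d1 i; have := d0 i; rewrite !mxE !mulN1r !subr_ge0.
move: (d 0 i) => y y0 y1.
suff : forall j, (j <= p)%N -> (1 + y) ^+ j <= 1 + (2 * j)%:R * y by apply.
elim=> [|j IH] jp; first by rewrite expr0 muln0 mul0r addr0.
have {}IH := IH (ltnW jp).
rewrite exprSr (le_trans (ler_wpM2r _ IH)) ?addr_ge0 //.
have -> : (1 + (2 * j)%:R * y) * (1 + y) = 1 + (2 * j)%:R * y + y + ((2 * j)%:R * y) * y.
  by ring.
have -> : 1 + (2 * j.+1)%:R * y = 1 + (2 * j)%:R * y + y + 1 * y.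
  by rewrite mulnS natrD; ring.
rewrite lerD2l ler_wpM2r // (le_trans _ y1) // ler_wpM2r // ler_nat leq_mul2l.
by rewrite ltnW ?orbT.
Qed.

(** The [p]-th power of each eigenvalue of [S] is one of the nonnegative summands of the trace,
    hence at most [L ^+ p]. *)
Lemma psd_scalar_sub_pow n (S : 'M[CC]_n) (L : CC) (p : nat) : (0 < p)%N ->
  0 <= L -> psd S -> \tr (S ^+ p) <= L ^+ p -> psd (L%:M - S).
Proof.
move=> p0 L0 /psd_spectral[U [d [UU' UU d0 ->]]].
rewrite sdiagX // tr_sdiag // => h.
rewrite -(sdiag_const UU') -scaleN1r sdiagZ sdiagD; apply/(psd_sdiag UU) => i.
rewrite !mxE mulN1r subr_ge0 -(ler_pXn2r p0) ?nnegrE //.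
apply: le_trans h; rewrite (bigD1 i) //= mxE lerDl sumr_ge0 // => j _.
by rewrite mxE exprn_ge0.
Qed.

(** * The greedy selection *)

Lemma expmxS n (A : 'M[CC]_n) k : A ^+ k.+1 = A *m A ^+ k.
Proof. exact: exprS. Qed.

Lemma expmxSr n (A : 'M[CC]_n) k : A ^+ k.+1 = A ^+ k *m A.
Proof. exact: exprSr. Qed.

Lemma expmxD n (A : 'M[CC]_n) k l : A ^+ (k + l) = A ^+ k *m A ^+ l.
Proof. exact: exprD. Qed.

Lemma expmx2 n (A : 'M[CC]_n) : A ^+ 2 = A *m A.
Proof. exact: expr2. Qed.

Lemma mxtrace_mulX n (X Y : 'M[CC]_n) k : \tr ((X *m Y) ^+ k) = \tr ((Y *m X) ^+ k).
Proof.
case: k => [//|k].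
have E : (X *m Y) ^+ k.+1 = X *m (Y *m X) ^+ k *m Y.
  elim: k => [|k IH]; first by rewrite expr0 mulmx1 expr1.
  by rewrite expmxS IH [in RHS]expmxS !mulmxA.
by rewrite E -mulmxA mxtrace_mulC -mulmxA expmxSr.
Qed.

(** Cauchy-Schwarz for [X] and its adjoint, in the form [2 |x| |y| <= |x|^2 + |y|^2] entry by
    entry. *)
Lemma norm_tr_sqr_le n (X : 'M[CC]_n) : `|\tr (X ^+ 2)| <= \tr (X *m adjm X).
Proof.
have -> : \tr (X *m adjm X) = \sum_i \sum_j `|X i j| ^+ 2.
  apply: eq_bigr => i _; rewrite mxE; apply: eq_bigr => j _.
  by rewrite mxE mul_conjc_normE.
have -> : \tr (X ^+ 2) = \sum_i \sum_j X i j * X j i.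
  by apply: eq_bigr => i _; rewrite expmx2 mxE.
apply: le_trans (ler_norm_sum _ _ _) _.
apply: le_trans (ler_sum _ (fun i _ => ler_norm_sum _ _ _)) _ => /=.
have h (i j : 'I_n) : `|X i j * X j i| <= (`|X i j| ^+ 2 + `|X j i| ^+ 2) / 2%:R.
  rewrite normrM ler_pdivlMr ?ltr0n // -subr_ge0.
  have -> : `|X i j| ^+ 2 + `|X j i| ^+ 2 - `|X i j| * `|X j i| * 2%:R
     = (`|X i j| - `|X j i|) ^+ 2 by ring.
  by rewrite -realEsqr rpredB // normr_real.
apply: le_trans (ler_sum _ (fun i _ => ler_sum _ (fun j _ => h i j))) _ => /=.
rewrite -subr_ge0 le_eqVlt eq_sym subr_eq0; apply/orP; left; apply/eqP.
have -> : \sum_i \sum_j (`|X i j| ^+ 2 + `|X j i| ^+ 2) / 2%:R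
   = (\sum_i \sum_j `|X i j| ^+ 2 + \sum_i \sum_j `|X j i| ^+ 2) / 2%:R.
  rewrite -big_split mulr_suml; apply: eq_bigr => i _.
  by rewrite -big_split mulr_suml.
by rewrite [X in _ + X]exchange_big /= -mulr2n -[X in X / _]mulr_natr mulfK // pnatr_eq0.
Qed.

Lemma tr_mul_herm_le n (A B : 'M[CC]_n) : adjm A = A -> adjm B = B ->
  \tr (A *m B) <= (\tr (A *m A) + \tr (B *m B)) / 2%:R.
Proof.
move=> hA hB; rewrite ler_pdivlMr ?ltr0n // -subr_ge0.
have := tr_psd_ge0 (psd_gram (A - B)).
rewrite -[- B]scaleN1r adjmD adjmZ hA hB.
have -> : conjc (-1) = -1 :> CC by rewrite -[RHS]conjcK; congr conjc; apply: esym; exact: rmorphN1.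
rewrite scaleN1r mulmxDl !mulmxDr mulNmx !mulmxN mulNmx opprK.
rewrite !raddfD /= !raddfN /= (mxtrace_mulC B A).
by congr (0 <= _); ring.
Qed.

(* The inequality of Lieb and Thirring at exponents that are powers of two,
   where Cauchy-Schwarz suffices; the two statements feed each other. *)
Lemma lieb_thirring_rec n k :
  (forall X : 'M[CC]_n, `|\tr (X ^+ (2 ^ k.+1))| <= \tr ((X *m adjm X) ^+ (2 ^ k))) /\
  (forall A B : 'M[CC]_n, psd A -> psd B ->
     `|\tr ((A *m B) ^+ (2 ^ k))| <= \tr (A ^+ (2 ^ k) *m B ^+ (2 ^ k))).
Proof.
elim: k => [|k [IHX IHA]]; split.
- by move=> X; rewrite expn0 expr1; apply: norm_tr_sqr_le.
- by move=> A B pA pB; rewrite expn0 !expr1 ger0_norm // tr_mul_psd_ge0.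
(* The first statement is applied to [X ^+ 2]. By cyclicity its bound is a power trace of a product
   of [X *m adjm X] and [adjm X *m X], which the second statement separates. *)
- move=> X; rewrite expnS exprM; apply: le_trans (IHX _) _.
  have -> : X ^+ 2 *m adjm (X ^+ 2) = X *m (X *m adjm X *m adjm X).
    by rewrite expmx2 adjmM !mulmxA.
  rewrite mxtrace_mulX.
  have -> : X *m adjm X *m adjm X *m X = (X *m adjm X) *m (adjm X *m X).
    by rewrite !mulmxA.
  have pXX := psd_gram X.
  have pXX' : psd (adjm X *m X) by have := psd_gram (adjm X); rewrite adjmK.
  set A := X *m adjm X in pXX *; set B := adjm X *m X in pXX' *.
  have h0 : 0 <= \tr ((A *m B) ^+ (2 ^ k)).
    have [C [pC CA]] := psd_sqrt pXX.
    rewrite -CA -mulmxA mxtrace_mulX -{1}(psd_herm pC).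
    by apply/tr_psd_ge0/psd_exp/psd_congr.
  have := IHA _ _ pXX pXX'; rewrite ger0_norm // => /le_trans; apply.
  (* Both traces on the right coincide, as [A] and [B] are the two products of [X] and [adjm X]. *)
  apply: le_trans (tr_mul_herm_le (psd_herm (psd_exp _ pXX)) (psd_herm (psd_exp _ pXX'))) _.
  rewrite -!expmxD addnn -mul2n -expnS.
  rewrite [\tr (B ^+ _)]mxtrace_mulX.
  by rewrite -mulr2n -[X in X / _]mulr_natr mulfK // pnatr_eq0.
(* The first statement for [A *m B] produces [A B B A], by cyclicity [B^2 A^2], and the second
   statement applies to the squares. *)
- move=> A B pA pB; apply: le_trans (IHX _) _.
  rewrite adjmM (psd_herm pA) (psd_herm pB).
  have -> : A *m B *m (B *m A) = A *m (B *m B *m A) by rewrite !mulmxA.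
  rewrite mxtrace_mulX.
  have -> : B *m B *m A *m A = (B *m B) *m (A *m A) by rewrite !mulmxA.
  have := IHA _ _ (psd_exp 2 pB) (psd_exp 2 pA).
  rewrite -!exprM -expnS mxtrace_mulC => h; apply: le_trans h.
  rewrite !expmx2; apply: le_trans (real_ler_norm _) => //.
  suff : 0 <= \tr ((B *m B *m (A *m A)) ^+ (2 ^ k)) by exact: ger0_real.
  have -> : (B *m B *m (A *m A)) = B *m (B *m A *m A) by rewrite !mulmxA.
  rewrite mxtrace_mulX.
  have -> : B *m A *m A *m B = (B *m A) *m adjm (B *m A).
    by rewrite adjmM (psd_herm pA) (psd_herm pB) !mulmxA.
  by apply/tr_psd_ge0/psd_exp/psd_gram.
Qed.

Lemma lieb_thirring n k (A B : 'M[CC]_n) : psd A -> psd B ->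
  `|\tr ((A *m B) ^+ (2 ^ k))| <= \tr (A ^+ (2 ^ k) *m B ^+ (2 ^ k)).
Proof. by case: (lieb_thirring_rec n k) => _; apply. Qed.

(** Let [p = 2 ^ k]. With [Y = S^(-1/2) Z S^(-1/2)] one has [S + Z = S^(1/2) (1 + Y) S^(1/2)], so
    cyclicity gives the trace of [(S (1 + Y))^p]. Lieb-Thirring separates it into [S^p (1 + Y)^p],
    and [(1 + Y)^p <= 1 + 2 p Y] makes the bound linear in [Z]. *)
Lemma tr_pow_add_le n k (S Z : 'M[CC]_n) (u : CC) :
  (2 * 2 ^ k)%:R <= u -> psd (S - u%:M) -> psd Z -> psd (1%:M - Z) ->
  \tr ((S + Z) ^+ (2 ^ k)) <=
    \tr (S ^+ (2 ^ k)) + (2 * 2 ^ k)%:R * \tr (S ^+ (2 ^ k).-1 *m Z).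
Proof.
set p := (2 ^ k)%N => pu pS pZ pZ1.
have p0 : (0 < p)%N by rewrite expn_gt0.
have u0 : 0 < u by apply: lt_le_trans pu; rewrite ltr0n muln_gt0.
have [A [B [pA pB AA AB]]] := psd_ge_sqrt_inv u0 pS.
have BA := mulmx1C AB.
pose Y := B *m Z *m B.
have pY : psd Y by rewrite /Y -{1}(psd_herm pB); apply: psd_congr.
have SZ : S + Z = A *m ((1%:M + Y) *m A).
  rewrite mulmxDl mul1mx mulmxDr AA; congr (_ + _).
  by rewrite /Y !mulmxA AB mul1mx -mulmxA BA mulmx1.
have p1Y : psd (1%:M + Y) by apply: psdD => //; apply: psd1.
have pS0 : psd S by rewrite -AA -{2}(psd_herm pA); apply: psd_gram.
have trE : \tr ((S + Z) ^+ p) = \tr ((S *m (1%:M + Y)) ^+ p).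
  by rewrite SZ mxtrace_mulX -mulmxA AA mxtrace_mulX.
have tr0 : 0 <= \tr ((S + Z) ^+ p) by apply/tr_psd_ge0/psd_exp/psdD.
rewrite -(ger0_norm tr0) trE; apply: le_trans (lieb_thirring k pS0 p1Y) _.
rewrite -/p.
(* [2 p Y <= 1] because [2 p Z <= 2 p <= u <= S]. *)
have p2Y : psd (1%:M - (2 * p)%:R *: Y).
  have -> : 1%:M - (2 * p)%:R *: Y = adjm B *m (S - (2 * p)%:R *: Z) *m B.
    rewrite (psd_herm pB) mulmxBr mulmxBl -scalemxAr -scalemxAl; congr (_ - _).
    by rewrite -AA !mulmxA BA mul1mx AB.
  apply: psd_congr.
  have -> : S - (2 * p)%:R *: Z
     = (S - u%:M) + (u - (2 * p)%:R)%:M + (2 * p)%:R *: (1%:M - Z).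
    by rewrite scalerBr scalemx1 raddfB /= !addrA !subrK.
  apply: psdD; last by apply: psdZ => //; rewrite ler0n.
  by apply: psdD => //; apply: psd_scalar; rewrite subr_ge0.
have SA1 : S *m A = A *m S by rewrite -AA mulmxA.
have SA j : S ^+ j *m A = A *m S ^+ j.
  elim: j => [|j IH]; first by rewrite expr0 mul1mx mulmx1.
  by rewrite expmxSr -mulmxA SA1 mulmxA IH -mulmxA.
(* The roots in [Y] cancel one power of [S], since [S] commutes with its root [A]. *)
have tY : \tr (S ^+ p *m Y) = \tr (S ^+ p.-1 *m Z).
  have -> : S ^+ p = A *m S ^+ p.-1 *m A.
    by rewrite -SA -mulmxA AA -expmxSr prednK.
  rewrite /Y !mulmxA -[_ *m A *m B]mulmxA AB mulmx1 -mulmxA mxtrace_mulC.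
  by rewrite -[Z *m B *m _]mulmxA !mulmxA -[Z *m B *m A]mulmxA BA mulmx1 mxtrace_mulC.
have := tr_mul_psd_ge0 (psd_exp p pS0) (psd_onem_pow pY p2Y).
rewrite mulmxBr mulmxDr mulmx1 -scalemxAr raddfB /= raddfD /= subr_ge0.
by rewrite linearZ /= tY.
Qed.

(** Returns from [S^(p-1)], the weight of the first-order term, to the potential [S^p] at the price
    of a factor [1 / u]. *)
Lemma tr_exp_ge n (S : 'M[CC]_n) (u : CC) j : 0 <= u -> psd (S - u%:M) ->
  u * \tr (S ^+ j) <= \tr (S ^+ j.+1).
Proof.
move=> u0 pS.
have pS0 : psd S by rewrite -[S](subrK u%:M); apply: psdD => //; apply: psd_scalar.
rewrite -subr_ge0; have := tr_mul_psd_ge0 (psd_exp j pS0) pS.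
by rewrite mulmxBr mul_mx_scalar raddfB /= linearZ /= expmxSr.
Qed.

Lemma tr_exp_gt0 n (S : 'M[CC]_n) (u : CC) j : (0 < n)%N -> 0 < u ->
  psd (S - u%:M) -> 0 < \tr (S ^+ j).
Proof.
move=> n0 u0 pS; elim: j => [|j IH]; first by rewrite expr0 mxtrace1 ltr0n.
by apply: lt_le_trans (tr_exp_ge j (ltW u0) pS); rewrite mulr_gt0.
Qed.

(** A matrix form of multiplicative weights: the next index is chosen against the state proportional
    to [S^(p-1)], the direction of the gradient of [tr S^p]. There [tr (S^(p-1) Z) <= e tr S^(p-1)
    <= (e / u) tr S^p], which is the growth factor; the initial [S = u 1] has potential [n u^p]. *)
Lemma greedy_tr_pow n (T : Type) (Z : T -> 'M[CC]_n) (e u : CC) k K :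
  (0 < n)%N -> 0 <= e -> (2 * 2 ^ k)%:R <= u ->
  (forall t, psd (Z t)) -> (forall t, psd (1%:M - Z t)) ->
  (forall H : 'M[CC]_n, psd H -> \tr H = 1 -> exists t, \tr (H *m Z t) <= e) ->
  exists s : seq T, size s = K /\
    \tr ((u%:M + \sum_(t <- s) Z t) ^+ (2 ^ k))
      <= n%:R * u ^+ (2 ^ k) * (1 + (2 * 2 ^ k)%:R * e / u) ^+ K.
Proof.
set p := (2 ^ k)%N => n0 e0 pu pZ pZ1 hH.
have p0 : (0 < p)%N by rewrite expn_gt0.
have u0 : 0 < u by apply: lt_le_trans pu; rewrite ltr0n muln_gt0.
elim: K => [|K [s [sK IH]]].
  exists [::]; split=> //; rewrite big_nil addr0 expr0 mulr1 -scalemx1.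
  have -> : (u *: 1%:M : 'M[CC]_n) ^+ p = (u ^+ p)%:M.
    elim: (p) => [|j IHj]; first by rewrite !expr0.
    by rewrite expmxS IHj -scalemxAl mul1mx scale_scalar_mx exprS.
  by rewrite mxtrace_scalar mulr_natl lexx.
set S := _ + _ in IH.
have pS : psd (S - u%:M).
  by rewrite /S addrC addKr; apply: psd_sum.
have t0 := tr_exp_gt0 p.-1 n0 u0 pS.
have pS0 : psd S by rewrite -[S](subrK u%:M); apply: psdD => //; apply/psd_scalar/ltW.
have [||t ht] := hH ((\tr (S ^+ p.-1))^-1 *: S ^+ p.-1).
- by apply: psdZ; [rewrite invr_ge0 ltW|apply: psd_exp].
- by rewrite linearZ /= mulVf // gt_eqF.
exists (rcons s t); split; first by rewrite size_rcons sK.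
rewrite -cats1 big_cat big_seq1 /= addrA -/S exprSr mulrA.
apply: le_trans (tr_pow_add_le pu pS (pZ t) (pZ1 t)) _.
rewrite -/p; apply: le_trans (ler_wpM2r _ IH); last first.
  by rewrite addr_ge0 // divr_ge0 ?mulr_ge0 ?ler0n // ltW.
rewrite mulrDr mulr1 lerD2l.
rewrite -scalemxAl linearZ /= mulrC ler_pdivrMr // in ht.
apply: le_trans (ler_wpM2l _ ht) _; first by rewrite ler0n.
rewrite [leRHS]mulrC mulrA -[leRHS]mulrA ler_wpM2l ?mulr_ge0 ?ler0n //.
rewrite mulrC ler_pdivlMr // mulrC.
by have := tr_exp_ge p.-1 (ltW u0) pS; rewrite prednK.
Qed.

(** The potential controls the largest eigenvalue of [u 1] plus the sum, and removing [u 1] only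
    lowers it. *)
Lemma greedy_sum_le n (T : Type) (Z : T -> 'M[CC]_n) (e u L : CC) k K :
  (0 < n)%N -> 0 <= e -> (2 * 2 ^ k)%:R <= u -> 0 <= L ->
  n%:R * u ^+ (2 ^ k) * (1 + (2 * 2 ^ k)%:R * e / u) ^+ K <= L ^+ (2 ^ k) ->
  (forall t, psd (Z t)) -> (forall t, psd (1%:M - Z t)) ->
  (forall H : 'M[CC]_n, psd H -> \tr H = 1 -> exists t, \tr (H *m Z t) <= e) ->
  exists s : seq T, size s = K /\ psd (L%:M - \sum_(t <- s) Z t).
Proof.
move=> n0 e0 pu L0 hL pZ pZ1 hH.
have [s [sK hs]] := greedy_tr_pow K n0 e0 pu pZ pZ1 hH.
exists s; split=> //.
have u0 : 0 <= u by apply: le_trans pu; rewrite ler0n.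
have ps : psd (u%:M + \sum_(t <- s) Z t).
  by apply: psdD; [apply: psd_scalar|apply: psd_sum].
have := psd_scalar_sub_pow (_ : (0 < 2 ^ k)%N) L0 ps (le_trans hs hL).
rewrite expn_gt0 => /(_ isT) h.
have -> : L%:M - \sum_(t <- s) Z t = (L%:M - (u%:M + \sum_(t <- s) Z t)) + u%:M.
  by rewrite opprD addrA addrAC subrK.
by apply: psdD => //; apply: psd_scalar.
Qed.

(** * Fidelity with a pure state *)

Lemma adjm_mul_eq0 m n (X : 'M[CC]_(m, n)) : adjm X *m X = 0 -> X = 0.
Proof.
move=> h; apply/matrixP => i j; move/matrixP/(_ j j)/eqP: h.
rewrite !mxE psumr_eq0 => [/allP/(_ i)|k _]; last first.
  by rewrite !mxE mulrC mul_conjc_ge0.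
rewrite mem_index_enum !mxE mulf_eq0 conjc_eq0 orbb => /(_ isT).
by move/eqP.
Qed.

Lemma tr_rank1 n (w : 'cV[CC]_n) : \tr (w *m adjm w) = (adjm w *m w) 0 0.
Proof. by rewrite mxtrace_mulC /mxtrace big_ord1. Qed.

(** [msqrt] is a choice known only through its specification, so its value has to come from
    uniqueness of the root. For rank one this is direct: [B] vanishes on the complement of [w],
    hence is a multiple of [w *m adjm w], and the trace of [B *m B] together with positivity fixes
    the factor. *)
Lemma psd_sqrt_rank1 n (B : 'M[CC]_n) (w : 'cV[CC]_n) (l : CC) :
  psd B -> B *m B = w *m adjm w -> 0 <= l -> (adjm w *m w) 0 0 = l ^+ 2 ->
  \tr B = l /\ l *: B = w *m adjm w.
Proof.
move=> pB BB l0 wl; have hB := psd_herm pB.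
have wl' : adjm w *m w = (l ^+ 2)%:M by rewrite [LHS]mx11_scalar wl.
have [l00|ln0] := eqVneq l 0.
  have w0 : w = 0.
    by apply: adjm_mul_eq0; rewrite wl' l00 expr0n /= raddf0.
  have B0 : B = 0 by apply: adjm_mul_eq0; rewrite hB BB w0 mul0mx.
  by rewrite B0 l00 scaler0 w0 mul0mx raddf0.
have l2 : l ^+ 2 != 0 by rewrite expf_neq0.
pose W := w *m adjm w.
have hW : adjm W = W by rewrite /W adjmM adjmK.
have WW : W *m W = l ^+ 2 *: W.
  by rewrite /W -mulmxA (mulmxA (adjm w)) wl' mul_scalar_mx -scalemxAr.
(* The difference [B (1 - W / l^2)] has Gram matrix zero, because [B B = W] and [W / l^2] is a
   projector. *)
have BE : B = (l ^+ 2)^-1 *: (B *m W).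
  apply/eqP; rewrite -subr_eq0; apply/eqP/adjm_mul_eq0.
  have -> : B - (l ^+ 2)^-1 *: (B *m W) = B *m (1%:M - (l ^+ 2)^-1 *: W).
    by rewrite mulmxBr mulmx1 scalemxAr.
  rewrite adjmM hB -mulmxA (mulmxA B) BB -/W mulmxBr mulmx1 -scalemxAr WW.
  by rewrite scalerA mulVf // scale1r subrr mulmx0.
have BE' : B = (l ^+ 2)^-1 *: (W *m B).
  rewrite -{1}hB {1}BE adjmZ adjmM hB hW conjc_ge0 //.
  by rewrite invr_ge0 exprn_ge0.
pose q := (adjm w *m B *m w) 0 0.
pose c := (l ^+ 2)^-1 * (l ^+ 2)^-1 * q.
have Bc : B = c *: W.
  rewrite {1}BE {1}BE' -scalemxAl scalerA.
  have -> : W *m B *m W = q *: W; last by rewrite scalerA.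
  rewrite /W !mulmxA -(mulmxA w (adjm w) B) -(mulmxA w _ w).
  by rewrite [adjm w *m B *m w]mx11_scalar mul_mx_scalar -scalemxAl.
have c0 : 0 <= c by rewrite !mulr_ge0 ?invr_ge0 ?exprn_ge0 //; apply: pB.
have trW : \tr W = l ^+ 2 by rewrite /W tr_rank1.
have cl : c * l = 1.
  have : \tr (B *m B) = l ^+ 2 by rewrite BB -/W.
  rewrite Bc -scalemxAl -scalemxAr WW !linearZ /= trW => h.
  have : (c * l) ^+ 2 = 1.
    by apply: (mulIf l2); rewrite mul1r -[RHS]h; ring.
  by move/eqP; rewrite expr2 -expr2 sqrf_eq1 => /orP[/eqP //|/eqP h1];
     have := mulr_ge0 c0 l0; rewrite h1 oppr_ge0 ler10.
split; first by rewrite Bc linearZ /= trW expr2 mulrA cl mul1r.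
by rewrite Bc scalerA mulrC cl scale1r.
Qed.

Lemma msqrtP n (A : 'M[CC]_n) : psd A -> psd (msqrt A) /\ msqrt A *m msqrt A = A.
Proof.
move=> pA; rewrite /msqrt.
exact: (epsilon_spec (inhabits 0) (fun B => psd B /\ B *m B = A) (psd_sqrt pA)).
Qed.

(** The projector onto [v] is its own root. With [R] the root of [rho] and [w = R *m v], the trace
    norm is the trace of the root of [w *m adjm w], that is the length of [w], and the fidelity is
    the square of that length. *)
Lemma fid_pure n (v : 'cV[CC]_n) (rho : 'M[CC]_n) :
  (adjm v *m v) 0 0 = 1 -> psd rho ->
  (fid (v *m adjm v) rho)%:C%C = (adjm v *m rho *m v) 0 0.
Proof.
move=> v1 pr.
have [pV VV] := msqrtP (psd_gram v).
have [pR RR'] := msqrtP pr.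
have VE : msqrt (v *m adjm v) = v *m adjm v.
  have [_] := psd_sqrt_rank1 pV VV ler01 (etrans v1 (esym (expr1n _ 2))).
  by rewrite scale1r.
rewrite /fid /tnorm VE; set R := msqrt rho in pR RR' *.
have -> : adjm (v *m adjm v *m R) *m (v *m adjm v *m R) = (R *m v) *m adjm (R *m v).
  have v1' : adjm v *m v = 1%:M by rewrite [LHS]mx11_scalar v1.
  rewrite !adjmM adjmK (psd_herm pR) !mulmxA -(mulmxA (R *m v) (adjm v) v) v1'.
  by rewrite mulmx1.
set w := R *m v.
have [pM MM] := msqrtP (psd_gram w).
have t0 := pr v; set t := (_ *m _) 0 0 in t0 *.
have wt : (adjm w *m w) 0 0 = sqrtC t ^+ 2.
  by rewrite sqrtCK /w adjmM (psd_herm pR) mulmxA -(mulmxA (adjm v)) RR'.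
have s0 : 0 <= sqrtC t by rewrite sqrtC_ge0.
have [-> _] := psd_sqrt_rank1 pM MM s0 wt.
rewrite -[RHS]sqrtCK; move: s0.
case: (sqrtC t) => a b /=; rewrite lecE /= => /andP[/eqP -> _].
by rewrite rmorphXn /=.
Qed.

(** * Operators indexed by finite types *)

Lemma opE_mkop (I : finType) (f : I -> I -> CC) i j : opE (mkop f) i j = f i j.
Proof. by rewrite /opE /mkop mxE !enum_rankK. Qed.

Lemma opP (I : finType) (A B : op I) :
  (forall i j, opE A i j = opE B i j) -> A = B.
Proof.
move=> h; apply/matrixP => p q.
by have := h (enum_val p) (enum_val q); rewrite /opE !enum_valK.
Qed.

Lemma eq_mkop (I : finType) (f g : I -> I -> CC) :
  (forall i j, f i j = g i j) -> mkop f = mkop g.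
Proof. by move=> h; apply: opP => i j; rewrite !opE_mkop. Qed.

Lemma opED (I : finType) (A B : op I) i j : opE (A + B) i j = opE A i j + opE B i j.
Proof. by rewrite /opE mxE. Qed.

Lemma opEZ (I : finType) a (A : op I) i j : opE (a *: A) i j = a * opE A i j.
Proof. by rewrite /opE mxE. Qed.

Lemma opE_sum (I : finType) (T : Type) (r : seq T) (P : pred T) (F : T -> op I) i j :
  opE (\sum_(t <- r | P t) F t) i j = \sum_(t <- r | P t) opE (F t) i j.
Proof. by rewrite /opE summxE. Qed.

Lemma opE_eunit (I : finType) (a b i j : I) :
  opE (eunit a b) i j = ((i == a) && (j == b))%:R.
Proof. exact: opE_mkop. Qed.

Lemma sum_enum_rank (I : finType) (V : nmodType) (F : 'I_#|I| -> V) :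
  \sum_p F p = \sum_(i : I) F (enum_rank i).
Proof. by rewrite (reindex enum_rank) //=; apply/onW_bij/enum_rank_bij. Qed.

Lemma tr_op (I : finType) (A : op I) : \tr A = \sum_i opE A i i.
Proof. exact: sum_enum_rank. Qed.

Lemma tr_eunit (I : finType) (a : I) : \tr (eunit a a) = 1.
Proof.
rewrite tr_op (bigD1 a) //= big1 => [|b /negbTE ba]; last by rewrite opE_eunit ba.
by rewrite opE_eunit eqxx addr0.
Qed.

Lemma psd_opP (I : finType) (A : op I) : psd A <->
  forall v : I -> CC, 0 <= \sum_i \sum_j conjc (v i) * opE A i j * v j.
Proof.
have E (w : 'cV[CC]_#|I|) : (adjm w *m A *m w) 0 0 =
    \sum_i \sum_j conjc (w (enum_rank i) 0) * opE A i j * w (enum_rank j) 0.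
  rewrite mxE sum_enum_rank exchange_big; apply: eq_bigr => j _ /=.
  rewrite mxE sum_enum_rank mulr_suml; apply: eq_bigr => i _.
  by rewrite mxE.
split=> [pA v|h w].
  have := pA (\col_p v (enum_val p)); rewrite E.
  by under eq_bigr do under eq_bigr do rewrite !mxE !enum_rankK.
by rewrite E; exact: (h (fun i => w (enum_rank i) 0)).
Qed.

Lemma psd_opgram (I : finType) (A : op I) : psd A ->
  exists g : I -> I -> CC, forall i j, opE A i j = \sum_t g i t * conjc (g j t).
Proof.
move=> /psd_sqrt[B [pB <-]]; exists (opE B) => i j.
rewrite -{2}(psd_herm pB) /opE mxE sum_enum_rank.
by apply: eq_bigr => t _; rewrite mxE.
Qed.

(** Positivity of most operators below is shown by exhibiting a Gram factor. The index type [T] is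
    free, so that sums and tensor products of factors can be indexed by sum and product types. *)
Lemma opgram_psd (I T : finType) (A : op I) (g : I -> T -> CC) :
  (forall i j, opE A i j = \sum_t g i t * conjc (g j t)) -> psd A.
Proof.
move=> h; apply/psd_opP => v.
have -> : \sum_i \sum_j conjc (v i) * opE A i j * v j
   = \sum_t (\sum_i conjc (v i) * g i t) * conjc (\sum_i conjc (v i) * g i t).
  under eq_bigr => i _ do under eq_bigr => j _ do rewrite h mulr_sumr mulr_suml.
  under eq_bigr => i _ do rewrite exchange_big.
  rewrite exchange_big; apply: eq_bigr => t _ /=.
  rewrite conjc_sum mulr_suml; apply: eq_bigr => i _.
  rewrite mulr_sumr; apply: eq_bigr => j _.
  by rewrite conjcM conjcK; ring.
by apply: sumr_ge0 => t _; apply: mul_conjc_ge0.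
Qed.

Lemma op_decomp (I : finType) (X : op I) :
  X = \sum_i \sum_j opE X i j *: eunit i j.
Proof.
apply: opP => a b; rewrite opE_sum (bigD1 a) //= [X in _ + X]big1 => [|i ia]; last first.
  rewrite opE_sum big1 // => j _.
  by rewrite opEZ opE_eunit eq_sym (negbTE ia) mulr0.
rewrite addr0 opE_sum (bigD1 b) //= [X in _ + X]big1 => [|j jb]; last first.
  by rewrite opEZ opE_eunit (eq_sym b) (negbTE jb) andbF mulr0.
by rewrite opEZ opE_eunit !eqxx mulr1 addr0.
Qed.

Lemma sum_delta (I : finType) (V : pzSemiRingType) (F : I -> V) (a : I) :
  \sum_i (a == i)%:R * F i = F a.
Proof.
rewrite (bigD1 a) //= eqxx mul1r big1 ?addr0 // => i ia.
by rewrite eq_sym (negbTE ia) mul0r.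
Qed.

Definition linf (I : finType) (f : op I -> CC) : Prop :=
  forall (a : CC) (X Y : op I), f (a *: X + Y) = a * f X + f Y.
Definition posf (I : finType) (f : op I -> CC) : Prop :=
  forall X : op I, psd X -> 0 <= f X.

Section linear.
Variables (I : finType).

Lemma linf0 (f : op I -> CC) : linf f -> f 0 = 0.
Proof.
by move=> h; have := h (-1) 0 0; rewrite scaler0 addr0 mulN1r addNr.
Qed.

Lemma linf_sum (f : op I -> CC) (T : Type) (r : seq T) (P : pred T)
    (c : T -> CC) (F : T -> op I) : linf f ->
  f (\sum_(t <- r | P t) c t *: F t) = \sum_(t <- r | P t) c t * f (F t).
Proof.
move=> h; apply: (big_rec2 (fun x y => f x = y)) => [|t x y _ <-].
  exact: linf0.
by rewrite h.
Qed.

Lemma linfB (f : op I -> CC) X Y : linf f -> f (X - Y) = f X - f Y.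
Proof. by move=> h; rewrite addrC -scaleN1r h mulN1r addrC. Qed.

Lemma linfZ (f : op I -> CC) a X : linf f -> f (a *: X) = a * f X.
Proof. by move=> h; rewrite -[a *: X]addr0 h linf0 // addr0. Qed.

Lemma linf_units (f : op I -> CC) X : linf f ->
  f X = \sum_i \sum_j opE X i j * f (eunit i j).
Proof.
move=> h; rewrite {1}[X]op_decomp.

rewrite (eq_bigr (fun i => 1 *: \sum_j opE X i j *: eunit i j)) => [|i _]; last by rewrite scale1r.
rewrite linf_sum //; apply: eq_bigr => i _.
by rewrite mul1r linf_sum.
Qed.

Lemma tr_linf : linf (fun X : op I => \tr X).
Proof. by move=> a X Y; rewrite raddfD /= linearZ. Qed.

Variable J : finType.
Implicit Type Phi : lmap I J.

Lemma is_lin_linf Phi p q : is_lin Phi -> linf (fun X => opE (Phi X) p q).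
Proof. by move=> h a X Y; rewrite h opED opEZ. Qed.

Lemma is_lin_sum Phi (T : Type) (r : seq T) (P : pred T) (c : T -> CC) (F : T -> op I) :
  is_lin Phi ->
  Phi (\sum_(t <- r | P t) c t *: F t) = \sum_(t <- r | P t) c t *: Phi (F t).
Proof.
move=> h; apply: opP => p q.
rewrite (linf_sum _ _ _ _ (is_lin_linf p q h)) opE_sum.
by apply: eq_bigr => t _; rewrite opEZ.
Qed.
End linear.

(** * Completely positive maps *)

Definition kraus (I J T : finType) (K : T -> J -> I -> CC) : lmap I J :=
  fun X => mkop (fun p q =>
    \sum_t \sum_i \sum_j K t p i * opE X i j * conjc (K t q j)).

Lemma kraus_CP (I J T : finType) (K : T -> J -> I -> CC) : CP (kraus K).
Proof.
move=> k X /psd_opgram[g gE].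
pose h (x : 'I_k * J) (ts : T * ('I_k * I)) :=
  \sum_i K ts.1 x.2 i * g (x.1, i) ts.2.
apply: (opgram_psd (g := h)) => -[a p] [b q].
rewrite !opE_mkop /= -(pair_bigA _ (fun t s => h (a, p) (t, s) * conjc (h (b, q) (t, s)))) /=.
apply: eq_bigr => t _.
under eq_bigr => i _ do under eq_bigr => j _ do rewrite opE_mkop gE mulr_sumr mulr_suml.
under eq_bigr => i _ do rewrite exchange_big.
rewrite exchange_big; apply: eq_bigr => s _ /=.
rewrite /h /= conjc_sum mulr_suml; apply: eq_bigr => i _.
rewrite mulr_sumr; apply: eq_bigr => j _.
by rewrite conjcM; ring.
Qed.

Lemma CP_comp (I J L : finType) (F : lmap I J) (G : lmap J L) :
  CP F -> CP G -> CP (fun X => G (F X)).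
Proof.
move=> cF cG k X pX.
suff -> : idt k (fun X => G (F X)) X = idt k G (idt k F X) by apply/cG/cF.
apply: opP => -[a p] [b q]; rewrite !opE_mkop /=; congr opE; congr G.
by apply: opP => i j; rewrite !opE_mkop.
Qed.

Lemma CP_sum (I J T : finType) (F : T -> lmap I J) :
  (forall t, CP (F t)) -> CP (fun X => \sum_t F t X).
Proof.
move=> cF k X pX.
have -> : idt k (fun X => \sum_t F t X) X = \sum_t idt k (F t) X.
  apply: opP => x y; rewrite opE_sum opE_mkop opE_sum.
  by apply: eq_bigr => t _; rewrite opE_mkop.
by apply: psd_sum => t _; apply: cF.
Qed.

Lemma CP_scale (I J : finType) (F : lmap I J) (a : CC) : 0 <= a ->
  CP F -> CP (fun X => a *: F X).
Proof.
move=> a0 cF k X pX.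
have -> : idt k (fun X => a *: F X) X = a *: idt k F X.
  by apply: opP => x y; rewrite opEZ !opE_mkop opEZ.
by apply: psdZ => //; apply: cF.
Qed.

Lemma is_lin_comp (I J L : finType) (F : lmap I J) (G : lmap J L) :
  is_lin F -> is_lin G -> is_lin (fun X => G (F X)).
Proof. by move=> lF lG a X Y; rewrite lF lG. Qed.

Lemma is_lin_bigsum (I J T : finType) (F : T -> lmap I J) :
  (forall t, is_lin (F t)) -> is_lin (fun X => \sum_t F t X).
Proof.
move=> lF a X Y; rewrite scaler_sumr -big_split; apply: eq_bigr => t _.
by rewrite lF.
Qed.

Lemma is_lin_scale (I J : finType) (F : lmap I J) (c : CC) :
  is_lin F -> is_lin (fun X => c *: F X).
Proof.
by move=> lF a X Y; rewrite lF scalerDr !scalerA mulrC.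
Qed.

Lemma CP_psd (I J : finType) (F : lmap I J) X : CP F -> psd X -> psd (F X).
Proof.
move=> cF /psd_opgram[g gE].
pose X1 : op ('I_1 * I)%type := mkop (fun x y => opE X x.2 y.2).
have : psd (idt 1 F X1).
  apply/cF/(opgram_psd (g := fun x t => g x.2 t)) => x y.
  by rewrite opE_mkop gE.
move=> /psd_opgram[h hE].
apply: (opgram_psd (g := fun x t => h (0, x) t)) => x y.
rewrite -hE opE_mkop /=; congr opE; congr F.
by apply: opP => i j; rewrite !opE_mkop.
Qed.

(* Choi's theorem: factor the image of the unnormalised maximally entangled state. *)
Lemma CP_kraus (I J : finType) (F : lmap I J) : is_lin F -> CP F ->
  exists (T : finType) (K : T -> J -> I -> CC), F = kraus K.
Proof.
move=> lF cF.
pose X : op ('I_#|I| * I)%type :=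
  mkop (fun x y => (enum_val x.1 == x.2)%:R * (enum_val y.1 == y.2)%:R).
have pX : psd X.
  apply: (opgram_psd (T := unit) (g := fun x t => (enum_val x.1 == x.2)%:R)) => x y.
  by rewrite opE_mkop big_const card_unit /= addr0 conjc_natr.
have [g gE] := psd_opgram (cF _ _ pX).
exists ('I_#|I| * J)%type, (fun t p i => g (enum_rank i, p) t).
apply/funext => Y; apply: opP => p q.
rewrite (linf_units _ (is_lin_linf p q lF)) opE_mkop.
rewrite [RHS]exchange_big; apply: eq_bigr => i _ /=.
rewrite exchange_big; apply: eq_bigr => j _ /=.
have -> : opE (F (eunit i j)) p q = opE (idt #|I| F X) (enum_rank i, p) (enum_rank j, q).
  rewrite opE_mkop /=; congr opE; congr F; apply: opP => a b.
  by rewrite !opE_mkop /= !enum_rankK -natrM mulnb (eq_sym i) (eq_sym j).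
by rewrite gE mulr_sumr; apply: eq_bigr => t _; ring.
Qed.

(** Evaluating [f] at rank-one operators gives the quadratic form of its matrix; the indices in
    [eunit j i] are swapped to match [\tr (A *m W)]. *)
Lemma posf_matrix (I : finType) (f : op I -> CC) : linf f -> posf f ->
  exists A : op I, psd A /\ forall W, f W = \tr (A *m W).
Proof.
move=> lf pf; exists (mkop (fun i j => f (eunit j i))); split.
  apply/psd_opP => v.
  pose W : op I := mkop (fun i j => v i * conjc (v j)).
  have pW : psd W.
    apply: (opgram_psd (T := unit) (g := fun i t => v i)) => i j.
    by rewrite opE_mkop big_const card_unit /= addr0.
  have := pf _ pW; rewrite (linf_units _ lf) exchange_big /=.
  by congr (0 <= _); apply: eq_bigr => i _; apply: eq_bigr => j _; rewrite !opE_mkop; ring.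
move=> W; rewrite (linf_units _ lf) tr_op exchange_big /=; apply: eq_bigr => i _.
rewrite /opE mxE sum_enum_rank; apply: eq_bigr => j _.
by rewrite mulrC -[X in _ = X * _]/(opE _ _ _) opE_mkop.
Qed.

(** The Kraus form of a positive functional, read as a map to operators on a one-dimensional space;
    it supplies the Kraus operators of [slice]. *)
Lemma posf_gram (I : finType) (f : op I -> CC) : linf f -> posf f ->
  exists h : I -> I -> CC, forall W,
    f W = \sum_t \sum_i \sum_j h t i * opE W i j * conjc (h t j).
Proof.
move=> lf pf; have [A [pA fA]] := posf_matrix lf pf.
have [g gE] := psd_opgram pA; exists (fun t i => conjc (g i t)) => W.
rewrite fA tr_op.
have E i : opE (A *m W) i i = \sum_j opE A i j * opE W j i.
  by rewrite /opE mxE sum_enum_rank.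
under eq_bigr => i _ do rewrite E.
under eq_bigr => i _ do under eq_bigr => j _ do rewrite gE mulr_suml.
rewrite exchange_big /=; under eq_bigr => i _ do rewrite exchange_big /=.
rewrite exchange_big /=; apply: eq_bigr => t _; apply: eq_bigr => i _.
by apply: eq_bigr => j _; rewrite conjcK; ring.
Qed.

(** * Splitting tensor powers *)

Section split.
Variables (l n : nat) (I : finType).
Implicit Types (a : {ffun 'I_l -> I}) (b : {ffun 'I_n -> I}) (x : {ffun 'I_(l + n) -> I}).

Definition fcat a b : {ffun 'I_(l + n) -> I} :=
  [ffun k => match fintype.split k with inl i => a i | inr j => b j end].
Definition flft x : {ffun 'I_l -> I} := [ffun k => x (lshift n k)].
Definition frgt x : {ffun 'I_n -> I} := [ffun k => x (rshift l k)].

Lemma fcat_l a b i : fcat a b (lshift n i) = a i.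
Proof. by rewrite ffunE (unsplitK (inl i)). Qed.

Lemma fcat_r a b i : fcat a b (rshift l i) = b i.
Proof. by rewrite ffunE (unsplitK (inr i)). Qed.

Lemma flft_cat a b : flft (fcat a b) = a.
Proof. by apply/ffunP => i; rewrite ffunE fcat_l. Qed.

Lemma frgt_cat a b : frgt (fcat a b) = b.
Proof. by apply/ffunP => i; rewrite ffunE fcat_r. Qed.

Lemma fcat_lr x : fcat (flft x) (frgt x) = x.
Proof. by apply/ffunP => k; rewrite -(splitK k); case: fintype.split => i; rewrite ?fcat_l ?fcat_r ffunE. Qed.

Lemma sum_fcat (V : nmodType) (F : {ffun 'I_(l + n) -> I} -> V) :
  \sum_x F x = \sum_a \sum_b F (fcat a b).
Proof.
rewrite pair_bigA (reindex (fun p : _ * _ => fcat p.1 p.2)) //=.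
exists (fun x => (flft x, frgt x)) => [[a b] _|x _] /=.
  by rewrite flft_cat frgt_cat.
exact: fcat_lr.
Qed.

(** The map [f (x) id], with [f] acting on the first [l] factors. For [f] a decoding event it
    returns the unnormalised state of the last [n] factors given that event. *)
Definition slice (f : op {ffun 'I_l -> I} -> CC) :
    lmap {ffun 'I_(l + n) -> I} {ffun 'I_n -> I} :=
  fun Y => mkop (fun p q => f (mkop (fun r s => opE Y (fcat r p) (fcat s q)))).

Definition tglue (rho : op {ffun 'I_l -> I}) :
    lmap {ffun 'I_n -> I} {ffun 'I_(l + n) -> I} :=
  fun X => mkop (fun x y => opE rho (flft x) (flft y) * opE X (frgt x) (frgt y)).

Lemma slice_kraus f : linf f -> posf f ->
  exists (T : finType) (K : T -> _), slice f = kraus K.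
Proof.
move=> lf pf; have [h hE] := posf_gram lf pf.
exists {ffun 'I_l -> I}, (fun t p x => (p == frgt x)%:R * h t (flft x)).
apply/funext => Y; apply: opP => p q; rewrite !opE_mkop hE.
apply: eq_bigr => t _; rewrite sum_fcat; apply: eq_bigr => a _.
under [RHS]eq_bigr => b _ do under eq_bigr => x _ do
  rewrite flft_cat frgt_cat -!mulrA.
under [RHS]eq_bigr => b _ do rewrite -mulr_sumr.
rewrite sum_delta sum_fcat; apply: eq_bigr => a' _.
under [RHS]eq_bigr => b _ do
  rewrite flft_cat frgt_cat conjcM conjc_natr mulrCA mulrA mulrCA.
by rewrite opE_mkop sum_delta; ring.
Qed.

Lemma tglue_kraus rho : psd rho -> exists (T : finType) (K : T -> _), tglue rho = kraus K.
Proof.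
move=> /psd_opgram[g gE].
exists {ffun 'I_l -> I}, (fun t x i => (frgt x == i)%:R * g (flft x) t).
apply/funext => X; apply: opP => x y; rewrite !opE_mkop gE mulr_suml.
apply: eq_bigr => t _.
under [RHS]eq_bigr => i _ do under eq_bigr => j _ do rewrite -!mulrA.
under [RHS]eq_bigr => i _ do rewrite -mulr_sumr.
rewrite sum_delta.
under [RHS]eq_bigr => j _ do rewrite conjcM conjc_natr mulrCA mulrA mulrCA.
by rewrite sum_delta; ring.
Qed.

Lemma slice_CP f : linf f -> posf f -> CP (slice f).
Proof. by move=> lf pf; have [T [K ->]] := slice_kraus lf pf; apply: kraus_CP. Qed.

Lemma slice_lin f : linf f -> is_lin (slice f).
Proof.
move=> lf a X Y; apply: opP => p q; rewrite opED opEZ !opE_mkop -lf; congr f.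
by apply: opP => i j; rewrite opED opEZ !opE_mkop opED opEZ.
Qed.

Lemma tglue_CP rho : psd rho -> CP (tglue rho).
Proof. by move=> pr; have [T [K ->]] := tglue_kraus pr; apply: kraus_CP. Qed.

Lemma tglue_lin rho : is_lin (tglue rho).
Proof.
by move=> a X Y; apply: opP => p q; rewrite opED opEZ !opE_mkop opED opEZ; ring.
Qed.

Lemma tr_tglue rho X : \tr (tglue rho X) = \tr rho * \tr X.
Proof.
rewrite !tr_op sum_fcat mulr_suml; apply: eq_bigr => a _.
by rewrite mulr_sumr; apply: eq_bigr => b _; rewrite opE_mkop flft_cat frgt_cat.
Qed.

Definition ptr (Y : op {ffun 'I_(l + n) -> I}) : op {ffun 'I_l -> I} :=
  mkop (fun r s => \sum_b opE Y (fcat r b) (fcat s b)).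

Lemma ptr_psd Y : psd Y -> psd (ptr Y).
Proof.
move=> /psd_opgram[g gE].
apply: (opgram_psd (g := fun r bt => g (fcat r bt.1) bt.2)) => r s.
rewrite opE_mkop -(pair_bigA _ (fun b t => g (fcat r b) t * conjc (g (fcat s b) t))) /=.
by apply: eq_bigr => b _.
Qed.

Lemma tr_ptr Y : \tr (ptr Y) = \tr Y.
Proof. by rewrite !tr_op sum_fcat; apply: eq_bigr => a _; rewrite opE_mkop. Qed.

Lemma tr_slice f Y : linf f -> \tr (slice f Y) = f (ptr Y).
Proof.
move=> lf.
have -> : ptr Y = \sum_b 1 *: mkop (fun r s => opE Y (fcat r b) (fcat s b)).
  apply: opP => r s; rewrite opE_mkop opE_sum; apply: eq_bigr => b _.
  by rewrite opEZ mul1r opE_mkop.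
rewrite linf_sum // tr_op; apply: eq_bigr => b _.
by rewrite opE_mkop mul1r.
Qed.
End split.

(** * Tensor powers of the channel and its dependence on the jammer state *)

Section nns.
Variable n : nat.

(** The Kraus operators of the power are tensor products of those of the factor; complete positivity
    of [tpow n N] is read off from this form. *)
Lemma tpow_kraus (I J T : finType) (K : T -> J -> I -> CC) :
  tpow n (kraus K) = kraus (fun (t : {ffun 'I_n -> T}) (p : {ffun 'I_n -> J})
     (i : {ffun 'I_n -> I}) => \prod_k K (t k) (p k) (i k)).
Proof.
apply/funext => X; apply: opP => p q; rewrite opE_mkop opE_sum.
rewrite [RHS]exchange_big /=; apply: eq_bigr => i _.
rewrite opE_sum exchange_big /=; apply: eq_bigr => j _.
rewrite opEZ opE_mkop.
have E k : opE (kraus K (eunit (i k) (j k))) (p k) (q k)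
    = \sum_t K t (p k) (i k) * conjc (K t (q k) (j k)).
  rewrite opE_mkop; apply: eq_bigr => t _.
  rewrite (bigD1 (i k)) //= [X in _ + X]big1 => [|a /negbTE ai]; last first.
    by apply: big1 => b _; rewrite opE_eunit ai mulr0 mul0r.
  rewrite addr0 (bigD1 (j k)) //= [X in _ + X]big1 => [|b /negbTE bj]; last first.
    by rewrite opE_eunit bj andbF mulr0 mul0r.
  by rewrite addr0 opE_eunit !eqxx mulr1.
under eq_bigr => k _ do rewrite E.
rewrite bigA_distr_bigA /= mulr_sumr; apply: eq_bigr => t _.
by rewrite big_split /= conjc_prod; ring.
Qed.

Lemma tpow_lin (I J : finType) (N : lmap I J) : is_lin (tpow n N).
Proof.
move=> a X Y; rewrite /tpow scaler_sumr -big_split; apply: eq_bigr => i _ /=.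
rewrite scaler_sumr -big_split; apply: eq_bigr => j _ /=.
by rewrite opED opEZ scalerDl scalerA.
Qed.

Lemma tpow_CP (I J : finType) (N : lmap I J) : is_lin N -> CP N -> CP (tpow n N).
Proof.
move=> lN cN; have [T [K ->]] := CP_kraus lN cN.
by rewrite tpow_kraus; apply: kraus_CP.
Qed.

(** On a matrix unit the trace factorises over the positions, and a position with [i k != j k]
    contributes zero. *)
Lemma tpow_TP (I J : finType) (N : lmap I J) : TP N -> TP (tpow n N).
Proof.
move=> tN X; rewrite !tr_op.
under eq_bigr => p _ do rewrite opE_sum.
rewrite exchange_big /=; apply: eq_bigr => i _.
under eq_bigr => p _ do rewrite opE_sum.
rewrite exchange_big /= (bigD1 i) //=.
have E j : \sum_p opE (opE X i j *: mkop (fun p q : {ffun 'I_n -> J} =>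
      \prod_(k < n) opE (N (eunit (i k) (j k))) (p k) (q k))) p p
    = opE X i j * (i == j)%:R.
  under eq_bigr => p _ do rewrite opEZ opE_mkop.
  rewrite -mulr_sumr; congr (_ * _).
  rewrite -(bigA_distr_bigA (fun k a => opE (N (eunit (i k) (j k))) a a)) /=.
  under eq_bigr => k _ do rewrite -tr_op tN tr_op.
  have F k : \sum_a opE (eunit (i k) (j k)) a a = (i k == j k)%:R.
    rewrite (bigD1 (i k)) //= big1 => [|a /negbTE ai]; last by rewrite opE_eunit ai.
    by rewrite addr0 opE_eunit eqxx.
  under eq_bigr => k _ do rewrite F.
  have [->|ij] := eqVneq i j; first by rewrite big1 // => k _; rewrite eqxx.
  have /existsP[k kij] : [exists k, i k != j k].
    rewrite -negb_forall; apply: contraNN ij => /forallP h.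
    by apply/eqP/ffunP => k; apply/eqP.
  by rewrite (bigD1 k) //= (negbTE kij) mul0r.
rewrite E eqxx mulr1 big1 ?addr0 // => j ji.
by rewrite E eq_sym (negbTE ji) mulr0.
Qed.

Variables (dA dJ dB : nat).
Variable N : lmap ('I_dA * 'I_dJ)%type 'I_dB.

Definition fpair (a : {ffun 'I_n -> 'I_dA}) (j : {ffun 'I_n -> 'I_dJ}) :
  {ffun 'I_n -> 'I_dA * 'I_dJ} := [ffun k => (a k, j k)].
Definition ffst (x : {ffun 'I_n -> 'I_dA * 'I_dJ}) : {ffun 'I_n -> 'I_dA} :=
  [ffun k => (x k).1].
Definition fsnd (x : {ffun 'I_n -> 'I_dA * 'I_dJ}) : {ffun 'I_n -> 'I_dJ} :=
  [ffun k => (x k).2].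

Lemma ffst_pair a j : ffst (fpair a j) = a.
Proof. by apply/ffunP => k; rewrite !ffunE. Qed.

Lemma fsnd_pair a j : fsnd (fpair a j) = j.
Proof. by apply/ffunP => k; rewrite !ffunE. Qed.

Lemma sum_fpair (V : nmodType) (F : {ffun 'I_n -> 'I_dA * 'I_dJ} -> V) :
  \sum_x F x = \sum_a \sum_j F (fpair a j).
Proof.
rewrite pair_bigA (reindex (fun p : _ * _ => fpair p.1 p.2)) //=.
exists (fun x => (ffst x, fsnd x)) => [[a b] _|x _] /=.
  by rewrite ffst_pair fsnd_pair.
by apply/ffunP => k; rewrite !ffunE; case: (x k).
Qed.

Definition tmix (sigma : op {ffun 'I_n -> 'I_dJ}) :
    lmap {ffun 'I_n -> 'I_dA} {ffun 'I_n -> 'I_dA * 'I_dJ} :=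
  fun rho => mkop (fun p q =>
    opE rho (ffst p) (ffst q) * opE sigma (fsnd p) (fsnd q)).

Lemma NnsE (sigma : op {ffun 'I_n -> 'I_dJ}) rho : Nns N sigma rho = tpow n N (tmix sigma rho).
Proof. by []. Qed.

Lemma tmix_CP sigma : psd sigma -> CP (tmix sigma).
Proof.
move=> /psd_opgram[g gE].
suff -> : tmix sigma = kraus (fun t x i => (ffst x == i)%:R * g (fsnd x) t).
  exact: kraus_CP.
apply/funext => X; apply: opP => x y; rewrite !opE_mkop gE mulr_sumr.
apply: eq_bigr => t _.
under [RHS]eq_bigr => i _ do under eq_bigr => j _ do rewrite -!mulrA.
under [RHS]eq_bigr => i _ do rewrite -mulr_sumr.
rewrite sum_delta.
under [RHS]eq_bigr => j _ do rewrite conjcM conjc_natr mulrCA mulrA mulrCA.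
by rewrite sum_delta; ring.
Qed.

Lemma tmix_lin sigma : is_lin (tmix sigma).
Proof.
by move=> a X Y; apply: opP => p q; rewrite opED opEZ !opE_mkop opED opEZ; ring.
Qed.

Lemma Nns_lin (sigma : op {ffun 'I_n -> 'I_dJ}) : is_lin (Nns N sigma).
Proof. exact: is_lin_comp (tmix_lin sigma) (tpow_lin N). Qed.

Lemma Nns_linr (rho : op {ffun 'I_n -> 'I_dA}) : is_lin (fun sigma => Nns N (n := n) sigma rho).
Proof.
move=> a X Y; rewrite !NnsE -tpow_lin; congr tpow.
by apply: opP => p q; rewrite opED opEZ !opE_mkop opED opEZ; ring.
Qed.

Hypothesis cN : channel N.

Lemma Nns_CP (sigma : op {ffun 'I_n -> 'I_dJ}) : psd sigma -> CP (Nns N sigma).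
Proof.
case: cN => lN pN tN ps; exact: CP_comp (tmix_CP ps) (tpow_CP lN pN).
Qed.

Lemma tr_Nns (sigma : op {ffun 'I_n -> 'I_dJ}) rho : \tr (Nns N sigma rho) = \tr sigma * \tr rho.
Proof.
case: cN => lN pN tN; rewrite NnsE tpow_TP // !tr_op sum_fpair mulrC.
rewrite mulr_suml; apply: eq_bigr => a _; rewrite mulr_sumr; apply: eq_bigr => j _.
by rewrite opE_mkop ffst_pair fsnd_pair.
Qed.
End nns.

(** Handles a jammer entangled across the two blocks. Sending [rho] over the first [l] uses and
    observing [e] there amounts to a functional on the first [l] factors of the jammer state, and
    the last [n] uses see the resulting conditional state. The channel is a product over positions,
    so both sides have the same expansion in matrix units. *)
Lemma slice_Nns (l n dA dJ dB : nat) (N : lmap ('I_dA * 'I_dJ)%type 'I_dB)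
    (e : op {ffun 'I_l -> 'I_dB} -> CC) (rho : op {ffun 'I_l -> 'I_dA})
    (X : op {ffun 'I_n -> 'I_dA}) (sigma : op {ffun 'I_(l + n) -> 'I_dJ}) : linf e ->
  slice e (Nns N sigma (tglue rho X))
    = Nns N (slice (fun W => e (Nns N W rho)) sigma) X.
Proof.
move=> le; apply: opP => p q.
pose NE m (x y : {ffun 'I_m -> 'I_dA * 'I_dJ}) (r s : {ffun 'I_m -> 'I_dB}) :=
  \prod_(k < m) opE (N (eunit (x k) (y k))) (r k) (s k).
have NnsEE m (W : op {ffun 'I_m -> 'I_dJ}) (Y : op {ffun 'I_m -> 'I_dA}) r s :
    opE (Nns N W Y) r s = \sum_x \sum_y
      (opE Y (ffst x) (ffst y) * opE W (fsnd x) (fsnd y)) * NE m x y r s.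
  rewrite NnsE opE_sum; apply: eq_bigr => x _.
  by rewrite opE_sum; apply: eq_bigr => y _; rewrite opEZ !opE_mkop.
rewrite opE_mkop NnsEE.
have fstc (x' : {ffun 'I_l -> 'I_dA * 'I_dJ}) (x : {ffun 'I_n -> 'I_dA * 'I_dJ}) :
    ffst (fcat x' x) = fcat (ffst x') (ffst x).
  apply/ffunP => k; rewrite -(splitK k); case: fintype.split => i /=;
  by rewrite ffunE ?fcat_l ?fcat_r ffunE.
have sndc (x' : {ffun 'I_l -> 'I_dA * 'I_dJ}) (x : {ffun 'I_n -> 'I_dA * 'I_dJ}) :
    fsnd (fcat x' x) = fcat (fsnd x') (fsnd x).
  apply/ffunP => k; rewrite -(splitK k); case: fintype.split => i /=;
  by rewrite ffunE ?fcat_l ?fcat_r ffunE.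
have NEc x' x y' y r s : NE (l + n)%N (fcat x' x) (fcat y' y) (fcat r p) (fcat s q)
    = NE l x' y' r s * NE n x y p q.
  rewrite /NE big_split_ord /=; congr (_ * _); apply: eq_bigr => k _.
    by rewrite !fcat_l.
  by rewrite !fcat_r.
have -> : mkop (fun r s => opE (Nns N sigma (tglue rho X)) (fcat r p) (fcat s q))
   = \sum_x 1 *: \sum_y (opE X (ffst x) (ffst y) * NE n x y p q) *:
        Nns N (mkop (fun a b => opE sigma (fcat a (fsnd x)) (fcat b (fsnd y)))) rho.
  apply: opP => r s; rewrite opE_mkop NnsEE sum_fcat exchange_big opE_sum /=.
  apply: eq_bigr => x _; rewrite scale1r opE_sum.
  under eq_bigr => x' _ do rewrite sum_fcat exchange_big /=.
  rewrite exchange_big /=; apply: eq_bigr => y _.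
  rewrite opEZ NnsEE mulr_sumr; apply: eq_bigr => x' _.
  rewrite mulr_sumr; apply: eq_bigr => y' _.
  by rewrite !opE_mkop NEc !fstc !sndc !flft_cat !frgt_cat; ring.
rewrite linf_sum //; apply: eq_bigr => x _.
rewrite mul1r linf_sum //; apply: eq_bigr => y _.
by rewrite opE_mkop; ring.
Qed.

(** * The success functional of a code *)

Lemma fid_pure_op (I : finType) (f : I -> CC) (rho : op I) :
  \sum_i conjc (f i) * f i = 1 -> psd rho ->
  (fid (mkop (fun i j => f i * conjc (f j))) rho)%:C%C
    = \sum_i \sum_j conjc (f i) * opE rho i j * f j.
Proof.
move=> f1 pr; pose v : 'cV[CC]_#|I| := \col_x f (enum_val x).
have -> : mkop (fun i j => f i * conjc (f j)) = v *m adjm v.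
  apply: opP => i j; rewrite opE_mkop /opE mxE big_ord1 !mxE.
  by rewrite !enum_rankK.
rewrite fid_pure //; last first.
  rewrite mxE sum_enum_rank -[RHS]f1; apply: eq_bigr => i _.
  by rewrite !mxE !enum_rankK.
rewrite mxE sum_enum_rank exchange_big; apply: eq_bigr => j _ /=.
rewrite !mxE sum_enum_rank mulr_suml; apply: eq_bigr => i _.
by rewrite !mxE !enum_rankK.
Qed.

Lemma psd_diag_ge0 (I : finType) (A : op I) i : psd A -> 0 <= opE A i i.
Proof.
move=> /psd_opgram[g ->]; apply: sumr_ge0 => t _; exact: mul_conjc_ge0.
Qed.

Section code_functional.
Variables (M2 e : nat).

(** [M2 ^ 2] times the entanglement fidelity of [T]: the quadratic form of its unnormalised Choi
    matrix at the sum of the basis vectors [(a, inl a)]. *)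
Definition qsum (T : lmap 'I_M2 ('I_M2 + 'I_e)%type) : CC :=
  \sum_a \sum_b opE (T (eunit a b)) (inl a) (inl b).

Lemma maxent_psd : psd (maxent M2).
Proof.
suff -> : maxent M2 = (M2%:R)^-1 *: mkop (fun p q => (p.1 == p.2)%:R * conjc ((q.1 == q.2)%:R)).
  apply: psdZ; first by rewrite invr_ge0 ler0n.
  apply: (opgram_psd (T := unit) (g := fun p t => (p.1 == p.2)%:R)) => x y.
  by rewrite opE_mkop big_const card_unit /= addr0.
by apply: opP => x y; rewrite opEZ !opE_mkop conjc_natr -natrM mulnb mulrC.
Qed.

Lemma maxent_block (a b : 'I_M2) :
  mkop (fun i j => opE (maxent M2) (a, i) (b, j)) = (M2%:R)^-1 *: eunit a b.
Proof.
by apply: opP => i j; rewrite opEZ opE_eunit !opE_mkop /= mulrC (eq_sym a) (eq_sym b).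
Qed.

(** A compression of the Choi matrix of [T] to the basis vectors [(a, inl a)]; multiplying by [M2]
    undoes the normalisation of [maxent]. *)
Lemma qsum_psd (T : lmap 'I_M2 ('I_M2 + 'I_e)%type) : (0 < M2)%N -> is_lin T -> CP T ->
  psd (mkop (fun a b => opE (T (eunit a b)) (inl a) (inl b))).
Proof.
move=> M20 lT cT.
have M2n0 : M2%:R != 0 :> CC by rewrite pnatr_eq0 -lt0n.
have /psd_opgram[g gE] := cT M2 (maxent M2) maxent_psd.
have : psd (mkop (fun a b => opE (idt M2 T (maxent M2)) (a, inl a) (b, inl b))).
  apply: (opgram_psd (g := fun a t => g (a, inl a) t)) => a b.
  by rewrite opE_mkop gE.
move=> /(psdZ (ler0n _ M2)); congr psd; apply: opP => a b.
rewrite opEZ !opE_mkop /= maxent_block.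
by rewrite (linfZ _ _ (is_lin_linf _ _ lT)) mulrA mulfV // mul1r.
Qed.

Lemma qsum_ge0 T : (0 < M2)%N -> is_lin T -> CP T -> 0 <= qsum T.
Proof.
move=> M20 lT cT; have /psd_opP/(_ (fun _ => 1)) := qsum_psd M20 lT cT.
congr (0 <= _); apply: eq_bigr => a _; apply: eq_bigr => b _.
by rewrite opE_mkop conjc1 mul1r mulr1.
Qed.

(* [1^* Q 1 <= M2 tr Q] for psd [Q], since the difference is half the sum of the
   values of [Q] at all [e_a - e_b]. *)
Lemma qsum_le T : (0 < M2)%N -> is_lin T -> CP T ->
  qsum T <= M2%:R * \sum_a opE (T (eunit a a)) (inl a) (inl a).
Proof.
move=> M20 lT cT; have := qsum_psd M20 lT cT.
set Q := mkop _ => pQ.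
have -> : qsum T = \sum_a \sum_b opE Q a b.
  by apply: eq_bigr => a _; apply: eq_bigr => b _; rewrite opE_mkop.
have -> : \sum_a opE (T (eunit a a)) (inl a) (inl a) = \sum_a opE Q a a.
  by apply: eq_bigr => a _; rewrite opE_mkop.
have [g gE] := psd_opgram pQ.
have h a b : 0 <= opE Q a a + opE Q b b - opE Q a b - opE Q b a.
  have -> : opE Q a a + opE Q b b - opE Q a b - opE Q b a
      = \sum_t (g a t - g b t) * conjc (g a t - g b t).
    rewrite !gE -!sumrN -!big_split /=; apply: eq_bigr => t _.
    have -> : conjc (g a t - g b t) = conjc (g a t) - conjc (g b t) by exact: rmorphB.
    by ring.
  by apply: sumr_ge0 => t _; apply: mul_conjc_ge0.
have : 0 <= \sum_a \sum_b (opE Q a a + opE Q b b - opE Q a b - opE Q b a).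
  by apply: sumr_ge0 => a _; apply: sumr_ge0.
have -> : \sum_a \sum_b (opE Q a a + opE Q b b - opE Q a b - opE Q b a)
   = 2%:R * (M2%:R * \sum_a opE Q a a - \sum_a \sum_b opE Q a b).
  under eq_bigr => a _ do rewrite !big_split /= !sumrN.
  rewrite !big_split /= !sumrN [X in _ - X]exchange_big /=.
  rewrite [X in _ + X - _ - _]sumr_const card_ord.
  under eq_bigr => a _ do rewrite sumr_const card_ord -mulr_natl.
  by rewrite -mulr_sumr -[X in _ + X - _ - _]mulr_natl; ring.
by rewrite pmulr_rge0 ?ltr0n // subr_ge0.
Qed.
End code_functional.

Section success.
Variables (dA dJ dB : nat).
Variable N : lmap ('I_dA * 'I_dJ)%type 'I_dB.
Hypothesis cN : channel N.
Variables (n M1 M2 : nat).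

Definition cetq e (P : lmap 'I_M2 {ffun 'I_n -> 'I_dA})
    (R : lmap {ffun 'I_n -> 'I_dB} ('I_M2 + 'I_e)%type)
    (sigma : op {ffun 'I_n -> 'I_dJ}) : CC :=
  qsum (fun X => R (Nns N sigma (P X))).

(** Defined on all operators and complex-valued, so that linearity in the jammer argument can be
    stated; for a code and a psd argument it agrees with [PCET]. *)
Definition succ (C : code dA dB n M1 M2) (sigma : op {ffun 'I_n -> 'I_dJ}) : CC :=
  (M1%:R)^-1 * (M2%:R ^+ 2)^-1 * \sum_m cetq (cenc C m) (cdec C m) sigma.

Lemma cetq_linf e P (R : lmap _ ('I_M2 + 'I_e)%type) : is_lin R -> linf (cetq P R).
Proof.
move=> lR a X Y; rewrite /cetq /qsum mulr_sumr -big_split; apply: eq_bigr => i _ /=.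
rewrite mulr_sumr -big_split; apply: eq_bigr => j _ /=.
have h := is_lin_comp (@Nns_linr n _ _ _ N (P (eunit i j))) lR.
by rewrite h opED opEZ.
Qed.

Lemma cetq_posf e P (R : lmap _ ('I_M2 + 'I_e)%type) : (0 < M2)%N ->
  is_lin P -> CP P -> is_lin R -> CP R -> posf (cetq P R).
Proof.
move=> M20 lP cP lR cR X pX; apply: qsum_ge0 => //.
  by apply: (is_lin_comp (G := R)) => //; apply: is_lin_comp lP (Nns_lin _ _).
by apply: (CP_comp (G := R)) => //; apply: CP_comp cP (Nns_CP cN pX).
Qed.

Lemma succ_linf C : is_code C -> linf (succ C).
Proof.
move=> [M10 M20 cP cR tR] a X Y; rewrite /succ.
under eq_bigr => m _ do rewrite (cetq_linf _ (let: And3 h _ _ := cR m in h)).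
by rewrite big_split -mulr_sumr /=; ring.
Qed.

Lemma succ_posf C : is_code C -> posf (succ C).
Proof.
move=> [M10 M20 cP cR tR] X pX.
rewrite !mulr_ge0 ?invr_ge0 ?exprn_ge0 ?ler0n //; apply: sumr_ge0 => m _.
by have [lP pP _] := cP m; have [lR pR _] := cR m; apply: cetq_posf.
Qed.

Lemma sum_eunit_tr (P : lmap 'I_M2 {ffun 'I_n -> 'I_dA}) : TP P ->
  \sum_a \tr (P (eunit a a)) = M2%:R.
Proof.
move=> tP; rewrite -[M2 in RHS]card_ord -sumr_const; apply: eq_bigr => a _.
by rewrite tP tr_eunit.
Qed.

(* The right-hand side is the average success probability when the code is
   used to send the classical messages [(m, a)]. *)
Lemma succ_le_classical C sigma : is_code C -> psd sigma ->
  succ C sigma <= ((M1 * M2)%:R)^-1 * \sum_m \sum_a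
    opE (cdec C m (Nns N sigma (cenc C m (eunit a a)))) (inl a) (inl a).
Proof.
move=> [M10 M20 cP cR tR] ps.
have M2n0 : M2%:R != 0 :> CC by rewrite pnatr_eq0 -lt0n.
rewrite natrM invfM /succ -!mulrA ler_wpM2l ?invr_ge0 ?ler0n //.
rewrite ler_pdivrMl ?exprn_gt0 ?ltr0n // mulr_sumr mulr_sumr; apply: ler_sum => m _.
have [lP pP _] := cP m; have [lR pR _] := cR m.
apply: le_trans (qsum_le _ _ _) _ => //.
- by apply: (is_lin_comp (G := cdec C m)) => //; apply: is_lin_comp lP (Nns_lin _ _).
- by apply: (CP_comp (G := cdec C m)) => //; apply: CP_comp pP (Nns_CP cN ps).
by rewrite expr2 -!mulrA mulVKf.
Qed.

Lemma psd_eunit (I : finType) (a : I) : psd (eunit a a).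
Proof.
apply: (opgram_psd (T := unit) (g := fun i t => (i == a)%:R)) => x y.
by rewrite opE_eunit big_const card_unit /= addr0 conjc_natr -natrM mulnb.
Qed.

Lemma succ_le C sigma : is_code C -> psd sigma -> succ C sigma <= \tr sigma.
Proof.
move=> cC ps; apply: le_trans (succ_le_classical cC ps) _.
case: cC => [M10 M20 cP cR tR].
rewrite ler_pdivrMl ?ltr0n ?muln_gt0 ?M10 //.
have -> : (M1 * M2)%:R * \tr sigma = \sum_(m < M1) \sum_(a < M2) \tr sigma.
  under eq_bigr => m _ do rewrite sumr_const card_ord.
  by rewrite sumr_const card_ord -mulrnA mulnC mulr_natl.
apply: ler_sum => m _.
have [lP pP tP] := cP m; have [lR pR nR] := cR m.
have -> : \sum_(a < M2) \tr sigma = \sum_a \tr (Nns N sigma (cenc C m (eunit a a))).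
  under [RHS]eq_bigr => a _ do rewrite tr_Nns //.
  by rewrite -mulr_sumr sum_eunit_tr // sumr_const card_ord mulr_natr.
apply: ler_sum => a _.
have pY : psd (Nns N sigma (cenc C m (eunit a a))).
  by apply/(CP_psd (Nns_CP cN ps))/(CP_psd pP)/psd_eunit.
apply: le_trans (nR _ pY); rewrite tr_op (bigD1 (inl a)) //= lerDl sumr_ge0 // => i _.
by apply/psd_diag_ge0/CP_psd.
Qed.

Lemma cdecR_CP (C : code dA dB n M1 M2) : (forall m, CP (cdec C m)) -> CP (cdecR C).
Proof.
move=> cR.
pose emb (m : 'I_M1) := kraus (fun (t : unit) (x : 'I_M1 * ('I_M2 + 'I_(cext C)))
   (i : 'I_M2 + 'I_(cext C)) => (m == x.1)%:R * (x.2 == i)%:R).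
suff -> : cdecR C = fun Y => \sum_m emb m (cdec C m Y).
  by apply: CP_sum => m; apply: CP_comp (cR m) (kraus_CP _).
apply/funext => Y; apply: opP => p q; rewrite opE_mkop opE_sum.
have E m : opE (emb m (cdec C m Y)) p q
    = (m == p.1)%:R * (m == q.1)%:R * opE (cdec C m Y) p.2 q.2.
  rewrite opE_mkop big_const card_unit /= addr0.
  under eq_bigr => i _ do under eq_bigr => j _ do
    rewrite conjcM !conjc_natr -!mulrA mulrCA.
  under eq_bigr => i _ do rewrite -mulr_sumr.
  rewrite sum_delta.
  under eq_bigr => i _ do rewrite mulrCA mulrA mulrC -!mulrA.
  by rewrite -mulr_sumr sum_delta; ring.
under eq_bigr => m _ do rewrite E -mulrA eq_sym.
by rewrite sum_delta; case: eqP => _; rewrite ?mul1r ?mul0r.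
Qed.

Lemma PCET_succ C sigma : is_code C -> psd sigma ->
  (PCET C (Nns N sigma))%:C%C = succ C sigma.
Proof.
move=> [M10 M20 cP cR tR] ps; rewrite /PCET /succ rmorphM rmorphV /= ?unitfE ?pnatr_eq0 -?lt0n //.
rewrite rmorph_nat rmorph_sum /= -mulrA; congr (_ * _); rewrite mulr_sumr.
apply: eq_bigr => m _.
have M2n0 : M2%:R != 0 :> CC by rewrite pnatr_eq0 -lt0n.
have [lP pP _] := cP m; have [lR pR _] := cR m.
set F := fun X => _.
have pF : psd (idt M2 F (maxent M2)).
  have cF : CP F.
    apply: (CP_comp (G := cdecR C)).
      by apply: (CP_comp (G := Nns N sigma)) => //; apply: Nns_CP.
    by apply: cdecR_CP => m'; have [] := cR m'.
  by apply/cF/maxent_psd.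
pose s : CC := (sqrtC M2%:R)^-1.
have s0 : 0 <= s by rewrite invr_ge0 sqrtC_ge0 ler0n.
have ss : s * s = (M2%:R)^-1 by rewrite -invfM -expr2 sqrtCK.
(* Amplitudes of the pure target: the basis vector [m] times the maximally entangled vector, with
   [s = M2^(-1/2)]. *)
pose f (p : 'I_M2 * ('I_M1 * ('I_M2 + 'I_(cext C)))) : CC := ((m, inl p.1) == p.2)%:R * s.
have cf p : conjc (f p) = f p by rewrite /f conjcM conjc_natr conjc_ge0.
have sumf (G : 'I_M2 * ('I_M1 * ('I_M2 + 'I_(cext C))) -> CC) :
    \sum_p f p * G p = s * \sum_a G (a, (m, inl a)).
  have -> : \sum_p f p * G p = \sum_a \sum_x f (a, x) * G (a, x).
    by rewrite pair_bigA; apply: eq_bigr => -[].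
  rewrite mulr_sumr; apply: eq_bigr => a _; under eq_bigr => x _ do rewrite /f -mulrA.
  exact: (sum_delta (fun x => s * G (a, x)) (m, inl a)).
have -> : cet_target m = mkop (fun p q => f p * conjc (f q)).
  apply: eq_mkop => -[a [m1 c]] [b [m2 d]] /=; rewrite cf /f /= mulrACA ss -natrM mulnb.
  rewrite !xpair_eqE !(eq_sym m).
  case: (m1 == m); case: (m2 == m); rewrite /= ?mul0r // ?andbF ?mul0r //.
  case: c d => [c|c] [d|d] /=; rewrite ?andbF ?mul0r //.
rewrite fid_pure_op //; last first.
  under eq_bigr => p _ do rewrite cf.
  rewrite sumf.
  have -> : \sum_(a < M2) f (a, (m, inl a)) = \sum_(a < M2) s.
    by apply: eq_bigr => a _; rewrite /f /= eqxx mul1r.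
  by rewrite sumr_const card_ord -mulr_natl mulrCA ss mulfV.
under eq_bigr => p _ do rewrite cf.
under eq_bigr => p _ do under eq_bigr => q _ do rewrite -mulrA.
under eq_bigr => p _ do rewrite -mulr_sumr.
rewrite sumf.
under eq_bigr => a _ do under eq_bigr => q _ do rewrite mulrC.
under eq_bigr => a _ do rewrite sumf.
rewrite -mulr_sumr mulrA ss expr2 invfM -!mulrA; congr (_ * _).
rewrite /cetq /qsum !mulr_sumr; apply: eq_bigr => a _.
rewrite mulr_sumr; apply: eq_bigr => b _.
rewrite opE_mkop /= maxent_block /F opE_mkop /= eqxx.
have l2 := is_lin_comp (is_lin_comp lP (Nns_lin N sigma)) lR.
by rewrite (linfZ _ _ (is_lin_linf (inl a) (inl b) l2)).
Qed.
End success.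

(** * Concatenation of codes *)

Section absorb.
Variables (M2 e : nat) (i0 : 'I_M2).

(* Moves the weight on the extension of the output space to the basis vector
   [i0], so that all codes share one output space. *)
Definition absorb : lmap ('I_M2 + 'I_e)%type ('I_M2 + 'I_0)%type := fun X =>
  mkop (fun p q => match p, q with
    | inl a, inl b => opE X (inl a) (inl b)
        + (a == i0)%:R * (b == i0)%:R * \sum_x opE X (inr x) (inr x)
    | _, _ => 0 end).

Lemma absorb_lin : is_lin absorb.
Proof.
move=> a X Y; apply: opP => -[p|[]//] [q|[]//]; rewrite opED opEZ !opE_mkop opED opEZ.
under eq_bigr => x _ do rewrite opED opEZ.
by rewrite big_split -mulr_sumr /=; ring.
Qed.

Lemma absorb_CP : CP absorb.
Proof.
move=> k X /psd_opgram[g gE].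
pose h (p : 'I_k * ('I_M2 + 'I_0))
    (s : ('I_k * ('I_M2 + 'I_e)) + ('I_e * ('I_k * ('I_M2 + 'I_e)))) : CC :=
  match p.2, s with
  | inl a, inl s => g (p.1, inl a) s
  | inl a, inr (x, s) => (a == i0)%:R * g (p.1, inr x) s
  | _, _ => 0 end.
apply: (opgram_psd (g := h)) => -[a [p|[]//]] [b [q|[]//]].
rewrite big_sumType /= opE_mkop /= opE_mkop opE_mkop gE; congr (_ + _).
have -> : \sum_i h (a, inl p) (inr i) * conjc (h (b, inl q) (inr i)) =
    \sum_x \sum_s h (a, inl p) (inr (x, s)) * conjc (h (b, inl q) (inr (x, s))).
  by rewrite pair_bigA; apply: eq_bigr => -[].
rewrite mulr_sumr; apply: eq_bigr => x _; rewrite opE_mkop gE mulr_sumr.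
by apply: eq_bigr => s _; rewrite /h /= conjcM conjc_natr; ring.
Qed.

Lemma absorb_TP : TP absorb.
Proof.
move=> X; rewrite !tr_op !big_sumType /= big_ord0 addr0.
under eq_bigr => a _ do rewrite opE_mkop.
rewrite big_split /=; congr (_ + _).
rewrite (bigD1 i0) //= eqxx !mul1r [X in _ + X]big1 ?addr0 // => a /negbTE ->.
by rewrite !mul0r.
Qed.

Lemma qsum_absorb (T : lmap 'I_M2 ('I_M2 + 'I_e)%type) : CP T ->
  qsum T <= qsum (fun X => absorb (T X)).
Proof.
move=> cT; apply: ler_sum => a _; apply: ler_sum => b _.
rewrite opE_mkop lerDl; case: eqP => [->|_]; last by rewrite !mul0r.
case: eqP => [->|_]; last by rewrite mulr0 mul0r.
rewrite !mul1r; apply: sumr_ge0 => x _.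
by apply/psd_diag_ge0/(CP_psd cT)/psd_eunit.
Qed.
End absorb.

Section codes.
Variables (dA dJ dB : nat).
Variable N : lmap ('I_dA * 'I_dJ)%type 'I_dB.
Hypothesis cN : channel N.

(** Each decoder is trace non-increasing because the sum preserves the trace and the other summands
    are positive. *)
Lemma is_codeP n M1 M2 (C : code dA dB n M1 M2) : (0 < M1)%N -> (0 < M2)%N ->
  (forall m, channel (cenc C m)) -> (forall m, is_lin (cdec C m)) ->
  (forall m, CP (cdec C m)) -> TP (fun X => \sum_(m < M1) cdec C m X) -> is_code C.
Proof.
move=> M10 M20 cP lR pR tR; split=> // m; split=> // X pX.
rewrite -(tR X) raddf_sum /= (bigD1 m) //= lerDl sumr_ge0 // => m' _.
by apply/tr_psd_ge0/CP_psd.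
Qed.

Definition code0 n M1 M2 (E : 'I_M1 -> lmap 'I_M2 {ffun 'I_n -> 'I_dA})
    (D : 'I_M1 -> lmap {ffun 'I_n -> 'I_dB} ('I_M2 + 'I_0)%type) :
  code dA dB n M1 M2 := Code E D.

Lemma code_absorb n M1 M2 (C : code dA dB n M1 M2) : is_code C ->
  exists D, is_code (code0 (cenc C) D) /\
    forall sigma, psd sigma -> succ N C sigma <= succ N (code0 (cenc C) D) sigma.
Proof.
move=> [M10 M20 cP cR tR]; pose i0 := Ordinal M20.
exists (fun m X => absorb i0 (cdec C m X)); split.
  apply: is_codeP => //=.
  - by move=> m; have [lR _ _] := cR m; apply: is_lin_comp lR (absorb_lin i0).
  - by move=> m; have [_ pR _] := cR m; apply: CP_comp pR (@absorb_CP _ _ i0).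
  move=> X; rewrite raddf_sum /= -[RHS]tR raddf_sum /=.
  by apply: eq_bigr => m _; rewrite absorb_TP.
move=> sigma ps; rewrite /succ ler_wpM2l ?mulr_ge0 ?invr_ge0 ?exprn_ge0 ?ler0n //.
apply: ler_sum => m _; have [lP pP _] := cP m; have [lR pR _] := cR m.
apply: (@qsum_absorb _ _ i0 (fun X => cdec C m (Nns N sigma (cenc C m X)))).
by apply: (CP_comp (G := cdec C m)) => //; apply: CP_comp pP (Nns_CP cN ps).
Qed.

Lemma is_lin_sum1 (I J T : finType) (Phi : lmap I J) (F : T -> op I) : is_lin Phi ->
  Phi (\sum_t F t) = \sum_t Phi (F t).
Proof.
move=> lP; have -> : \sum_t F t = \sum_t 1 *: F t.
  by apply: eq_bigr => t _; rewrite scale1r.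
by rewrite is_lin_sum //; apply: eq_bigr => t _; rewrite scale1r.
Qed.

Lemma is_linZ (I J : finType) (Phi : lmap I J) c X : is_lin Phi ->
  Phi (c *: X) = c *: Phi X.
Proof.
move=> lP; apply: opP => p q.
by rewrite opEZ (linfZ _ _ (is_lin_linf p q lP)).
Qed.

Section catcode.
Variables (l n M1 M2 : nat) (J : finType).
Variables (rho : J -> op {ffun 'I_l -> 'I_dA}) (e : J -> op {ffun 'I_l -> 'I_dB} -> CC).
Variables (E : J -> 'I_M1 -> lmap 'I_M2 {ffun 'I_n -> 'I_dA}).
Variables (D : J -> 'I_M1 -> lmap {ffun 'I_n -> 'I_dB} ('I_M2 + 'I_0)%type).
Hypotheses (J0 : (0 < #|J|)%N) (drho : forall j, density (rho j)).
Hypotheses (le : forall j, linf (e j)) (pe : forall j, posf (e j)).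
Hypothesis (se : forall W, \sum_j e j W = \tr W).
Hypothesis (cC : forall j, is_code (code0 (E j) (D j))).

(* The index [j] is drawn uniformly, sent over the first [l] uses of the
   channel, and selects the code for the remaining [n] uses. *)
Definition catcode : code dA dB (l + n) M1 M2 :=
  code0 (fun m X => (#|J|%:R)^-1 *: \sum_j tglue (rho j) (E j m X))
        (fun m Y => \sum_j D j m (slice (e j) Y)).

Let J1 : #|J|%:R != 0 :> CC. Proof. by rewrite pnatr_eq0 -lt0n. Qed.

Lemma catcode_is_code : is_code catcode.
Proof.
have [j0 _] : exists j : J, true by move/card_gt0P: J0 => [j]; exists j.
have [M10 M20 _ _ _] := cC j0.
have cE j m : channel (E j m) by have [_ _ h _ _] := cC j; apply: h.
have cD j m : [/\ is_lin (D j m), CP (D j m) & TNI (D j m)].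
  by have [_ _ _ h _] := cC j; apply: h.
apply: is_codeP => //=.
- move=> m; split.
  + apply/is_lin_scale/is_lin_bigsum => j; have [lE _ _] := cE j m.
    exact: is_lin_comp lE (tglue_lin _).
  + apply: CP_scale; first by rewrite invr_ge0 ler0n.
    apply: CP_sum => j; have [_ pE _] := cE j m; have [pr _] := drho j.
    exact: CP_comp pE (tglue_CP pr).
  + move=> X; rewrite linearZ /= raddf_sum /=.
    rewrite (eq_bigr (fun _ => \tr X)) => [|j _]; last first.
      by rewrite tr_tglue; have [_ ->] := drho j; have [_ _ ->] := cE j m; rewrite mul1r.
    by rewrite sumr_const -[X in _ * X]mulr_natl mulKf.
- move=> m; apply: is_lin_bigsum => j; have [lD _ _] := cD j m.
  exact: is_lin_comp (slice_lin (le j)) lD.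
- move=> m; apply: CP_sum => j; have [_ pD _] := cD j m.
  exact: CP_comp (slice_CP (le j) (pe j)) pD.
move=> Y; rewrite exchange_big /= raddf_sum /=.
have E1 j : \tr (\sum_(m < M1) D j m (slice (e j) Y)) = e j (ptr Y).
  by have [_ _ _ _ /(_ (slice (e j) Y)) /= ->] := cC j; rewrite tr_slice.
by under eq_bigr => j _ do rewrite E1; rewrite se tr_ptr.
Qed.

(** The weight of decoding [i] when [j] was sent over the prefix and the jammer holds [W] there. *)
Let A (i j : J) (W : op {ffun 'I_l -> 'I_dJ}) : CC := e i (Nns N W (rho j)).

Let A_linf i j : linf (A i j).
Proof. by move=> c X Y; rewrite /A (Nns_linr N (rho j)) le. Qed.

Let A_posf i j : posf (A i j).
Proof.
move=> X pX; apply: pe; apply: (CP_psd (Nns_CP cN pX)).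
by case: (drho j).
Qed.

Let A_le i j X : psd X -> A i j X <= \tr X.
Proof.
move=> pX; have [pr tr1] := drho j.
have -> : \tr X = \tr (Nns N X (rho j)) by rewrite tr_Nns // tr1 mulr1.
rewrite -se (bigD1 i) //= lerDl sumr_ge0 // => k _.
by apply: pe; apply: (CP_psd (Nns_CP cN pX)).
Qed.

(** The encoder averages over [j] and the decoder sums over [i], so the success is a double sum of
    nonnegative terms, of which those with [i = j] are kept. *)
Lemma succ_catcode_diag sigma : psd sigma ->
  (#|J|%:R)^-1 * \sum_j succ N (code0 (E j) (D j)) (slice (A j j) sigma)
    <= succ N catcode sigma.
Proof.
move=> ps.
have [j0 _] : exists j : J, true by move/card_gt0P: J0 => [j]; exists j.
have [M10 M20 _ _ _] := cC j0.
have cE j m : channel (E j m) by have [_ _ h _ _] := cC j; apply: h.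
have cD j m : [/\ is_lin (D j m), CP (D j m) & TNI (D j m)].
  by have [_ _ _ h _] := cC j; apply: h.
rewrite /succ -mulr_sumr mulrCA ler_wpM2l ?mulr_ge0 ?invr_ge0 ?exprn_ge0 ?ler0n //.
rewrite exchange_big /= mulr_sumr; apply: ler_sum => m _.
have -> : cetq N (cenc catcode m) (cdec catcode m) sigma
   = (#|J|%:R)^-1 * \sum_i \sum_j cetq N (E j m) (D i m) (slice (A i j) sigma).
  have X1 X : cdec catcode m (Nns N sigma (cenc catcode m X))
     = (#|J|%:R)^-1 *: \sum_i \sum_j D i m (Nns N (slice (A i j) sigma) (E j m X)).
    rewrite /catcode /code0 /= [RHS]scaler_sumr; apply: eq_bigr => i _; have [lD _ _] := cD i m.
    rewrite (is_linZ _ _ (Nns_lin N sigma)) (is_lin_sum1 _ (Nns_lin N sigma)).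
    rewrite (is_linZ _ _ (slice_lin (le i))) (is_lin_sum1 _ (slice_lin (le i))).
    rewrite (is_linZ _ _ lD) (is_lin_sum1 _ lD); congr (_ *: _).
    by apply: eq_bigr => j _; rewrite slice_Nns.
  rewrite /cetq /qsum.
  under eq_bigr => a _ do under eq_bigr => b _ do rewrite X1 opEZ opE_sum.
  under eq_bigr => a _ do rewrite -mulr_sumr exchange_big /=.
  rewrite -mulr_sumr exchange_big /=; congr (_ * _); apply: eq_bigr => i _.
  under eq_bigr => a _ do under eq_bigr => b _ do rewrite opE_sum.
  under eq_bigr => a _ do rewrite exchange_big /=.
  by rewrite exchange_big.
rewrite ler_wpM2l ?invr_ge0 ?ler0n //; apply: ler_sum => i _.
rewrite [leRHS](bigD1 i) //= lerDl sumr_ge0 // => j _.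
have [lE pE _] := cE j m; have [lD pD _] := cD i m.
apply: cetq_posf => //.
exact: (CP_psd (slice_CP (@A_linf i j) (@A_posf i j))).
Qed.

(** A union bound. [\tr - A j j] is a positive functional, so failing to decode [j] removes a
    positive part from the jammer state of the remainder, and by [succ_le] the success drops by at
    most the trace of that part, [1 - A j j (ptr sigma)]. *)
Lemma succ_catcode sigma : density sigma ->
  (#|J|%:R)^-1 * \sum_j e j (Nns N (ptr sigma) (rho j)) - 1
  + (#|J|%:R)^-1 * \sum_j succ N (code0 (E j) (D j)) (slice (fun W => \tr W) sigma)
    <= succ N catcode sigma.
Proof.
move=> [ps ts]; apply: le_trans (succ_catcode_diag ps).
have one : 1 = (#|J|%:R)^-1 * \sum_(j : J) (1 : CC) by rewrite sumr_const mulVf.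
rewrite [X in _ - X + _]one -mulrBr -mulrDr ler_wpM2l ?invr_ge0 ?ler0n //.
rewrite -sumrB -big_split; apply: ler_sum => j _ /=.
set C := code0 (E j) (D j).
have lf : linf (fun W => \tr W - A j j W).
  by move=> c X Y; rewrite A_linf (@tr_linf _ c X Y); ring.
have pf : posf (fun W => \tr W - A j j W).
  by move=> X pX; rewrite subr_ge0; apply: A_le.
have pS := CP_psd (slice_CP lf pf) ps.
have SE : slice (fun W => \tr W - A j j W) sigma
    = slice (fun W => \tr W) sigma - slice (A j j) sigma.
  by apply: opP => p q; rewrite -scaleN1r opED opEZ !opE_mkop mulN1r.
have := succ_le cN (cC j) pS; rewrite SE.
rewrite (linfB _ _ (succ_linf N (cC j))) (linfB _ _ (@tr_linf _)).
rewrite (tr_slice _ (@tr_linf _)) (tr_slice _ (@A_linf j j)) tr_ptr ts.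
rewrite -/(A j j (ptr sigma)) -/C => h.
rewrite -subr_ge0; move: h; rewrite -subr_ge0; congr (0 <= _).
by ring.
Qed.
End catcode.
End codes.

(** * Derandomisation *)

Lemma tr_posf_psd n (A : 'M[CC]_n) : (forall W, psd W -> 0 <= \tr (A *m W)) -> psd A.
Proof.
move=> h v; have := h _ (psd_gram v).
by rewrite mulmxA mxtrace_mulC mulmxA /mxtrace big_ord1.
Qed.

Section derandomization.
Variables (dA dJ dB : nat).
Variable N : lmap ('I_dA * 'I_dJ)%type 'I_dB.
Hypotheses (cN : channel N) (dJ0 : (0 < dJ)%N).

(** [Z t] is the operator of the failure of [t], so the premise on [H] in [greedy_sum_le] says that
    each jammer state has a good code. [T] consists of codes without extension space, which gives
    all selected codes one type. *)
Lemma derandomize n M1 M2 (eps u L : CC) k K : 0 <= eps ->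
  (2 * 2 ^ k)%:R <= u -> 0 <= L ->
  (dJ ^ n)%:R * u ^+ (2 ^ k) * (1 + (2 * 2 ^ k)%:R * eps / u) ^+ K <= L ^+ (2 ^ k) ->
  (forall sigma : op {ffun 'I_n -> 'I_dJ}, density sigma ->
     exists C : code dA dB n M1 M2, is_code C /\ 1 - eps <= succ N C sigma) ->
  exists (E : 'I_K -> 'I_M1 -> lmap 'I_M2 {ffun 'I_n -> 'I_dA})
         (D : 'I_K -> 'I_M1 -> lmap {ffun 'I_n -> 'I_dB} ('I_M2 + 'I_0)%type),
    (forall i, is_code (code0 (E i) (D i))) /\
    forall sigma : op {ffun 'I_n -> 'I_dJ}, density sigma ->
      \sum_i (1 - succ N (code0 (E i) (D i)) sigma) <= L.
Proof.
move=> e0 pu L0 hL hC.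
pose T := {ED : ('I_M1 -> lmap 'I_M2 {ffun 'I_n -> 'I_dA}) *
  ('I_M1 -> lmap {ffun 'I_n -> 'I_dB} ('I_M2 + 'I_0)%type) | is_code (code0 ED.1 ED.2)}.
pose sc (t : T) := succ N (code0 (sval t).1 (sval t).2).
have /choice[Z hZ] (t : T) : exists Z : op {ffun 'I_n -> 'I_dJ},
    [/\ psd Z, psd (1%:M - Z) & forall W, \tr (W *m Z) = \tr W - sc t W].
  have ct := svalP t.
  have [A [pA sA]] := posf_matrix (succ_linf N ct) (succ_posf cN ct).
  have E W : \tr (W *m (1%:M - A)) = \tr W - sc t W.
    by rewrite mxtrace_mulC mulmxBl mul1mx raddfB /= -sA.
  exists (1%:M - A); split=> //.
    apply: tr_posf_psd => W pW; rewrite mxtrace_mulC E subr_ge0.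
    exact: succ_le.
  by rewrite opprB addrC subrK.
have cf : #|{ffun 'I_n -> 'I_dJ}| = (dJ ^ n)%N by rewrite card_ffun !card_ord.
have [|||s [sK ps]] := @greedy_sum_le #|{ffun 'I_n -> 'I_dJ}| T Z eps u L k K _ e0 pu L0 _
   (fun t => let: And3 h _ _ := hZ t in h) (fun t => let: And3 _ h _ := hZ t in h).
- by rewrite cf expn_gt0 dJ0.
- by rewrite cf.
- move=> H pH tH; have [C [cC sC]] := hC H (conj pH tH).
  have [D [cD sD]] := code_absorb cN cC.
  exists (exist _ (cenc C, D) cD); have [_ _ ->] := hZ (exist _ (cenc C, D) cD).
  rewrite tH lerBlDr -lerBlDl; apply: le_trans sC (sD _ pH).
pose tp : K.-tuple T := Tuple (introT eqP sK).
exists (fun i => (sval (tnth tp i)).1), (fun i => (sval (tnth tp i)).2); split.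
  by move=> i; apply: (svalP (tnth tp i)).
move=> sigma [pS tS]; have := tr_mul_psd_ge0 pS ps.
rewrite mulmxBr raddfB /= mul_mx_scalar linearZ /= tS mulr1 subr_ge0.
rewrite (big_tuple _ _ tp) /= mulmx_sumr raddf_sum /=.
apply: le_trans; rewrite le_eqVlt; apply/orP; left; apply/eqP.
by apply: eq_bigr => i _; have [_ _ ->] := hZ (tnth tp i); rewrite tS.
Qed.

Definition good n M1 M2 (eps : RR) := exists C : code dA dB n M1 M2,
  is_code C /\ forall s, density s -> 1 - eps <= PCET C (Nns N s).
Definition rgood n M1 M2 (eps : RR) := forall s : op {ffun 'I_n -> 'I_dJ}, density s ->
  exists C : code dA dB n M1 M2, is_code C /\ 1 - eps <= PCET C (Nns N s).

Lemma PCET_geP n M1 M2 (C : code dA dB n M1 M2) s (x : RR) : is_code C -> density s ->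
  (x <= PCET C (Nns N s)) = (x%:C%C <= succ N C s).
Proof. by move=> cC [ps _]; rewrite -PCET_succ // lecR. Qed.

(** With [p = 2 ^ k >= n] the dimension factor is at most [dJ ^ p], and the growth factor is at most
    [exp (2 p eps / a) <= exp p]; both join the [p]-th power on the right. *)
Lemma greedy_bound (n k K : nat) (a eps : RR) : (n <= 2 ^ k)%N -> (0 < K)%N ->
  0 <= eps -> 0 < a -> 2 * eps <= a ->
  (dJ ^ n)%:R * (a * K%:R) ^+ (2 ^ k) * (1 + (2 * 2 ^ k)%:R * eps / (a * K%:R)) ^+ K
    <= (expR 1 * dJ%:R * (a * K%:R)) ^+ (2 ^ k) :> RR.
Proof.
move: (2 ^ k)%N => p np K0 e0 a0 ea.
have K0' : 0 < K%:R :> RR by rewrite ltr0n.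
have aK0 : 0 < a * K%:R by rewrite mulr_gt0.
have x0 : 0 <= (2 * p)%:R * eps / (a * K%:R).
  by rewrite divr_ge0 ?mulr_ge0 ?ler0n // ltW.
rewrite [leRHS]exprMn mulrAC ler_pM2r ?exprn_gt0 // [leRHS]exprMn mulrC ler_pM //.
- by rewrite exprn_ge0 // addr_ge0.
- apply: (@le_trans _ _ (expR ((2 * p)%:R * eps / (a * K%:R)) ^+ K)).
    by rewrite lerXn2r ?nnegrE ?addr_ge0 ?expR_ge0 ?expR_ge1Dx.
  rewrite -!expRM_natl ler_expR mulr1 natrM.
  have -> : K%:R * (2%:R * p%:R * eps / (a * K%:R)) = p%:R * (2 * eps / a).
    by field; rewrite !gt_eqF.
  by rewrite ler_piMr ?ler0n // ler_pdivrMr // mul1r.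
by rewrite natrX ler_weXn2l // ler1n.
Qed.

(** Up to the constant [e * dJ], [a] is the mean failure allowed per selected code, and [u = a K].
    The bound [4 n <= a K] yields [2 * 2 ^ k <= u], and [2 e2 <= a] keeps the growth of the
    potential below [exp (2 ^ k)]. *)
Lemma good_combine l n M1' M2' M1 M2 (e1 e2 a : RR) : (0 < n)%N ->
  0 <= e2 -> 0 < a -> 2 * e2 <= a -> (4 * n)%:R <= a * (M1' * M2')%:R ->
  good l M1' M2' e1 -> rgood n M1 M2 e2 ->
  good (l + n) M1 M2 (e1 + expR 1 * dJ%:R * a).
Proof.
move=> n0 e20 a0 ea aK [C0 [cC0 hC0]] hr.
have [M10 M20 cP cR tR] := cC0.
have [D0 [cD0 sD0]] := code_absorb cN cC0.
pose J := ('I_M1' * 'I_M2')%type.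
have cardJ : #|{: J}| = (M1' * M2')%N by rewrite card_prod !card_ord.
have J0 : (0 < #|{: J}|)%N by rewrite cardJ muln_gt0 M10.
(* The exponent with [n < 2 ^ k <= 2 n]. *)
pose k := (trunc_log 2 n).+1.
have nk : (n <= 2 ^ k)%N by rewrite ltnW // trunc_log_ltn.
have kn : (2 * 2 ^ k <= 4 * n)%N.
  by rewrite /k expnS mulnA leq_mul2l trunc_logP // orbT.
pose K := #|{: J}|.
pose u : RR := a * K%:R.
pose L : RR := expR 1 * dJ%:R * u.
have u0 : 0 <= u by rewrite mulr_ge0 ?ler0n // ltW.
have L0 : 0 <= L by apply: mulr_ge0 => //; rewrite mulr_ge0 ?expR_ge0 ?ler0n.
have [|||||E [D [cED hED]]] := @derandomize n M1 M2 e2%:C%C u%:C%C L%:C%C k K.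
- by rewrite lecR.
- rewrite -(rmorph_nat (real_complex RR)) lecR; apply: le_trans (_ : (4 * n)%:R <= _).
    by rewrite ler_nat.
  by rewrite /u /K cardJ.
- by rewrite lecR.
- have := greedy_bound nk J0 e20 a0 ea; rewrite -/K -/u -/L -lecR.
  rewrite !(rmorphM, rmorphXn, rmorphD, rmorph_nat, rmorph1) /= fmorphV /=.
  by rewrite rmorphM !rmorph_nat.
- move=> s ds; have [C [cC hC]] := hr s ds; exists C; split=> //.
  by move: hC; rewrite PCET_geP // rmorphB.
(* The prefix code used classically: [(m, a)] is sent as the basis state [a] through encoder [m] and
   read off in the same basis. *)
pose rho (j : J) := cenc C0 j.1 (eunit j.2 j.2).
pose e (j : J) (W : op {ffun 'I_l -> 'I_dB}) : CC := opE (D0 j.1 W) (inl j.2) (inl j.2).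
have [_ _ _ cR0 tR0] := cD0.
have drho j : density (rho j).
  have [lP pP tP] := cP j.1; split; first exact/(CP_psd pP)/psd_eunit.
  by rewrite tP tr_eunit.
have le j : linf (e j) by have [lR _ _] := cR0 j.1; apply: is_lin_linf.
have pe j : posf (e j).
  by move=> X pX; have [_ pR _] := cR0 j.1; apply/psd_diag_ge0/CP_psd.
have se W : \sum_j e j W = \tr W.
  rewrite -[RHS]tR0 raddf_sum /=.
  rewrite -(pair_bigA _ (fun m i => opE (D0 m W) (inl i) (inl i))) /=.
  by apply: eq_bigr => m _; rewrite tr_op big_sumType /= big_ord0 addr0.
pose E' (j : J) := E (enum_rank j); pose D' (j : J) := D (enum_rank j).
have cC' j : is_code (code0 (E' j) (D' j)) by apply: cED.
exists (catcode rho e E' D'); split; first exact: catcode_is_code.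
move=> s ds; rewrite PCET_geP //; last exact: catcode_is_code.
apply: le_trans (succ_catcode cN J0 drho le pe se cC' ds).
(* The marginals of the jammer state on the prefix and on the remainder. *)
have ds1 : density (ptr s) by case: ds => ps ts; split; [exact: ptr_psd|rewrite tr_ptr].
have ds2 : density (slice (fun W => \tr W) s : op {ffun 'I_n -> 'I_dJ}).
  case: ds => ps ts; split; last by rewrite (tr_slice _ (@tr_linf _)) tr_ptr.
  apply: (CP_psd (slice_CP _ _)) => //; first exact: tr_linf.
  by move=> X; apply: tr_psd_ge0.
have K0 : 0 < K%:R :> CC by rewrite ltr0n.
have h1 : (1 - e1)%:C%C <= (K%:R)^-1 * \sum_j e j (Nns N (ptr s) (rho j)).
  have := hC0 _ ds1; rewrite PCET_geP // => /le_trans; apply.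
  case: (ds1) => ps1 _; apply: le_trans (sD0 _ ps1) _.
  apply: le_trans (succ_le_classical cN cD0 ps1) _.
  by rewrite /K cardJ pair_bigA.
have h2 : (1 - expR 1 * dJ%:R * a)%:C%C <=
    (K%:R)^-1 * \sum_j succ N (code0 (E' j) (D' j)) (slice (fun W => \tr W) s).
  rewrite rmorphB rmorph1 lerBlDr -lerBlDl.
  have -> : 1 - K%:R^-1 * \sum_j succ N (code0 (E' j) (D' j)) (slice (fun W => \tr W) s)
     = K%:R^-1 * \sum_i (1 - succ N (code0 (E i) (D i)) (slice (fun W => \tr W) s)).
    rewrite sumrB [X in _ * (_ - X)]sum_enum_rank mulrBr sumr_const card_ord mulVf //.
    by rewrite gt_eqF.
  rewrite ler_pdivrMl //; apply: le_trans (hED _ ds2) _.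
  rewrite /L /u -(rmorph_nat (real_complex RR)) -rmorphM lecR.
  by rewrite le_eqVlt; apply/orP; left; apply/eqP; ring.
have -> : (1 - (e1 + expR 1 * dJ%:R * a))%:C%C
    = (1 - e1)%:C%C - 1 + (1 - expR 1 * dJ%:R * a)%:C%C.
  by rewrite -(rmorph1 (real_complex RR)) -rmorphB -rmorphD; congr (_%:C%C); ring.
by rewrite lerD // lerB.
Qed.
End derandomization.

(** * Limits and rates *)

Definition ev0 (R : realType) (e : nat -> R) := forall d : R, 0 < d ->
  exists n0 : nat, forall n, (n0 <= n)%N -> `|e n| < d.

Lemma ev0P (R : realType) (e : nat -> R) : ev0 e <-> e @ \oo --> (0 : R).
Proof.
split=> [h|/cvgr0Pnorm_lt h d d0].
  apply/cvgr0Pnorm_lt => d d0; have [n0 hn] := h d d0.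
  by exists n0 => // n /= nn; apply: hn.
by have [n0 _ hn] := h d d0; exists n0 => n nn; apply: hn.
Qed.

Lemma cvg1_ev0 (R : realType) (u : nat -> \bar R) : u @ \oo --> 1%E ->
  (forall n, (0 <= u n <= 1)%E) -> exists e : nat -> R,
    [/\ ev0 e, forall n, 0 <= e n & forall n, u n = (1 - e n)%:E].
Proof.
move=> cu u01; exists (fun n => 1 - fine (u n)).
have uE n : u n = (fine (u n))%:E.
  rewrite fineK // ge0_fin_numE; last by have /andP[] := u01 n.
  by have /andP[_ h] := u01 n; apply: le_lt_trans h _; rewrite ltry.
split.
- apply/ev0P; rewrite -(subrr (1 : R)); apply: cvgB; first exact: cvg_cst.
  exact: (fine_cvg cu).
- by move=> n; have /andP[_] := u01 n; rewrite uE lee_fin subr_ge0.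
by move=> n; rewrite opprB addrC subrK.
Qed.

Lemma rate_geP (M : nat -> nat) (r : RR) : rate_ge M r <->
  forall x : RR, x < r -> exists n0 : nat, forall n, (n0 <= n)%N ->
    x <= ln (M n)%:R / (n%:R * ln 2).
Proof.
set u := fun n : nat => (ln (M n)%:R / (n%:R * ln 2) : RR).
have E : limn_einf (fun n => (u n)%:E) = ereal_sup (range (einfs (fun n => (u n)%:E))).
  by rewrite limn_einf_lim; apply/cvg_lim => //; apply: cvg_einfs_sup.
rewrite /rate_ge E; split=> [h x xr|h].
  have : (x%:E < ereal_sup (range (einfs (fun n => (u n)%:E))))%E.
    by apply: lt_le_trans h; rewrite lte_fin.
  move=> /ereal_sup_gt[_ [n0 _ <-]] hx; exists n0 => n nn.
  rewrite -lee_fin; apply: le_trans (ltW hx) _.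
  by apply: ereal_inf_lbound; exists n.
apply/lee_subgt0Pr => d d0.
have [|n0 hn] := h (r - d); first by rewrite ltrBlDr ltrDl.
apply: (@le_trans _ _ (einfs (fun n => (u n)%:E) n0)).
  by apply: le_ereal_inf_tmp => _ [n /= nn <-]; rewrite lee_fin; apply: hn.
by apply: ereal_sup_ubound; exists n0.
Qed.

Section ev0_theory.
Variable R : realType.
Implicit Types e f : nat -> R.

Lemma ev0D e f : ev0 e -> ev0 f -> ev0 (fun n => e n + f n).
Proof.
by move=> /ev0P he /ev0P hf; apply/ev0P; rewrite -[X in _ --> X](addr0 (0 : R)); apply: cvgD.
Qed.

Lemma ev0Ml (c : R) e : ev0 e -> ev0 (fun n => c * e n).
Proof.
move=> /ev0P he; apply/ev0P; rewrite -[X in _ --> X](mulr0 c).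
by apply: cvgM => //; apply: cvg_cst.
Qed.

Lemma ev0_comp e (q : nat -> nat) : (forall m, exists n0, forall n, (n0 <= n)%N -> (m <= q n)%N) ->
  ev0 e -> ev0 (fun n => e (q n)).
Proof.
move=> hq he d d0; have [m hm] := he d d0; have [n0 hn] := hq m.
by exists n0 => n nn; apply/hm/hn.
Qed.

Lemma ev0_le e f : (exists n0, forall n, (n0 <= n)%N -> 0 <= f n <= e n) ->
  ev0 e -> ev0 f.
Proof.
move=> [n0 h] he d d0; have [n1 hn] := he d d0.
exists (maxn n0 n1) => n; rewrite geq_max => /andP[/h/andP[f0 fe] /hn].
by apply: le_lt_trans; rewrite !ger0_norm // (le_trans f0).
Qed.

Lemma ev0_eq e f : (exists n0, forall n, (n0 <= n)%N -> f n = e n) -> ev0 e -> ev0 f.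
Proof.
move=> [n0 h] he d d0; have [n1 hn] := he d d0.
by exists (maxn n0 n1) => n; rewrite geq_max => /andP[/h -> /hn].
Qed.

Lemma ev0_invS : ev0 (fun n => n.+1%:R^-1 : R).
Proof.
move=> d d0; exists (Num.truncn d^-1) => n nn.
rewrite ger0_norm ?invr_ge0 ?ler0n // -[ltRHS]invrK ltf_pV2 ?posrE ?ltr0n ?invr_gt0 //.
by apply: lt_le_trans (truncnS_gt _) _; rewrite ler_nat.
Qed.
End ev0_theory.

Lemma ev0_cvg1 (R : realType) (e : nat -> R) (u : nat -> \bar R) : ev0 e ->
  (forall n, ((1 - e n)%:E <= u n <= 1)%E) -> u @ \oo --> 1%E.
Proof.
move=> /ev0P ce hu.
apply: (@squeeze_cvge _ _ _ _ (fun n => (1 - e n)%:E) _ (fun=> 1%E)).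
- by apply: nearW => n; apply: hu.
- apply: cvg_EFin; first by apply: nearW.
  rewrite -[X in _ --> X](subr0 (1 : R)); apply: cvgB => //; exact: cvg_cst.
exact: cvg_cst.
Qed.

Lemma prob_integral_cst (R : realType) (d : measure_display) (T : measurableType d)
    (P : probability T R) (c : R) : (\int[P]_w c%:E = c%:E)%E.
Proof.
by rewrite integral_cst // [X in (_ * X)%E](probability_setT P) mule1.
Qed.

Lemma prob_integral_le (R : realType) (d : measure_display) (T : measurableType d)
    (P : probability T R) (f : T -> R) (c : R) : measurable_fun [set: T] f ->
  (forall w, 0 <= f w) -> (forall w, f w <= c) -> (\int[P]_w (f w)%:E <= c%:E)%E.
Proof.
move=> mf f0 fc; apply: (@le_trans _ _ (\int[P]_w (cst c%:E w))%E).
  apply: ge0_le_integral => //.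
  - by move=> w _; rewrite lee_fin.
  - by apply/measurable_realfun.measurable_EFinP.
  - by move=> w _; rewrite lee_fin.
by rewrite prob_integral_cst.
Qed.

Lemma density_eunit (I : finType) (i : I) : density (eunit i i).
Proof. by split; [exact: psd_eunit|exact: tr_eunit]. Qed.

Lemma density0 (I : finType) (s : op I) : density s -> (0 < #|I|)%N.
Proof.
move=> [_ ts]; rewrite lt0n; apply/eqP => I0.
have : (1 : CC) = 0.
  by rewrite -ts tr_op big1 // => i _; have := card0_eq I0 i.
by move/eqP; rewrite oner_eq0.
Qed.

(** * The achievable regions in terms of sequences of good codes *)

Section regions.
Variables (dA dJ dB : nat).
Variable N : lmap ('I_dA * 'I_dJ)%type 'I_dB.
Hypothesis cN : channel N.

Section bounds.
Variables (n M1 M2 : nat) (C : code dA dB n M1 M2) (s : op {ffun 'I_n -> 'I_dJ}).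
Hypotheses (cC : is_code C) (ds : density s).

Lemma PCET_ge0 : 0 <= PCET C (Nns N s).
Proof. by rewrite (PCET_geP cN) //; apply: succ_posf; case: ds. Qed.

Lemma PCET_le1 : PCET C (Nns N s) <= 1.
Proof.
case: ds => ps ts; rewrite -lecR PCET_succ // rmorph1 -ts.
exact: succ_le.
Qed.
End bounds.

Lemma ffun_density n : (0 < dJ)%N -> exists s : op {ffun 'I_n -> 'I_dJ}, density s.
Proof.
by move=> dJ0; exists (eunit [ffun=> Ordinal dJ0] [ffun=> Ordinal dJ0]); apply: density_eunit.
Qed.

Lemma Ad_intro (r : RR * RR) (M1 M2 : nat -> nat) (e : nat -> RR) : (0 < dJ)%N ->
  0 <= r.1 -> 0 <= r.2 -> (forall n, good N n (M1 n) (M2 n) (e n)) -> ev0 e ->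
  rate_ge M1 r.1 -> rate_ge M2 r.2 -> Ad_CET N r.
Proof.
move=> dJ0 r1 r2 hg he h1 h2; split=> //; exists M1, M2.
pose C n := projT1 (cid (hg n)).
have hC n : is_code (C n) /\ forall s, density s -> 1 - e n <= PCET (C n) (Nns N s).
  exact: (projT2 (cid (hg n))).
exists C; split=> //; first by move=> n; have [] := hC n.
apply: (ev0_cvg1 he) => n; have [cC hn] := hC n; apply/andP; split.
  by apply: le_ereal_inf_tmp => _ [s ds <-]; rewrite lee_fin hn.
have [s ds] := ffun_density n dJ0.
apply: (@le_trans _ _ (PCET (C n) (Nns N s))%:E); last by rewrite lee_fin PCET_le1.
by apply: ereal_inf_lbound; exists s.
Qed.

(** For [dJ = 0] no density exists at any [n >= 1], and the infimum over the empty set is [+oo].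
    Length zero is left out, since its space has dimension one. *)
Lemma cvg1_dJ_gt0 (f : forall n, op {ffun 'I_n -> 'I_dJ} -> \bar RR) :
  (fun n => ereal_inf [set f n s | s in [set s | density s]]) @ \oo --> 1%E ->
  (0 < dJ)%N.
Proof.
move=> h; rewrite lt0n; apply/eqP => dJ0.
suff : (fun n => ereal_inf [set f n s | s in [set s | density s]]) @ \oo --> +oo%E.
  by move/(cvg_unique (@ereal_hausdorff _) h).
apply: cvg_near_cst; exists 1%N => // n /= n0.
suff -> : [set s | density s] = (set0 : set (op {ffun 'I_n -> 'I_dJ})).
  by rewrite image_set0 ereal_inf0.
apply/seteqP; split=> // s /= /density0.
by rewrite card_ffun !card_ord dJ0 exp0n.
Qed.

Lemma Ad_elim (r : RR * RR) : Ad_CET N r ->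
  [/\ (0 < dJ)%N, 0 <= r.1, 0 <= r.2 & exists (M1 M2 : nat -> nat) (e : nat -> RR),
    [/\ forall n, good N n (M1 n) (M2 n) (e n), ev0 e, rate_ge M1 r.1 & rate_ge M2 r.2]].
Proof.
move=> [r1 r2 [M1 [M2 [C [cC h1 h2 cv]]]]].
have dJ0 := cvg1_dJ_gt0 cv; split=> //; exists M1, M2.
have [|e [he e0 eE]] := cvg1_ev0 cv.
  move=> n; apply/andP; split.
    by apply: le_ereal_inf_tmp => _ [s ds <-]; rewrite lee_fin PCET_ge0.
  have [s ds] := ffun_density n dJ0.
  apply: (@le_trans _ _ (PCET (C n) (Nns N s))%:E); last by rewrite lee_fin PCET_le1.
  by apply: ereal_inf_lbound; exists s.
exists e; split=> // n; exists (C n); split=> // s ds.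
by rewrite -lee_fin -eE; apply: ereal_inf_lbound; exists s.
Qed.

Lemma Ar_elim (r : RR * RR) : Ar_CET N r ->
  [/\ (0 < dJ)%N, 0 <= r.1, 0 <= r.2 & exists (M1 M2 : nat -> nat) (e : nat -> RR),
    [/\ forall n, rgood N n (M1 n) (M2 n) (e n), ev0 e, forall n, 0 <= e n,
        rate_ge M1 r.1 & rate_ge M2 r.2]].
Proof.
move=> [r1 r2 [M1 [M2 [d [Om [P [C [cC mC h1 h2 cv]]]]]]]].
have dJ0 := cvg1_dJ_gt0 cv; split=> //; exists M1, M2.
have le1 n s (c : RR) : density s -> (forall w, PCET (C n w) (Nns N s) <= c) ->
    (\int[P n]_w (PCET (C n w) (Nns N s))%:E <= c%:E)%E.
  move=> ds hc; apply: prob_integral_le => //; first exact: mC.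
  by move=> w; apply: PCET_ge0.
have [|e [he e0 eE]] := cvg1_ev0 cv.
  move=> n; apply/andP; split.
    apply: le_ereal_inf_tmp => _ [s ds <-]; apply: integral_ge0 => w _.
    by rewrite lee_fin PCET_ge0.
  have [s ds] := ffun_density n dJ0.
  apply: le_trans (le1 n s 1 ds _); last by move=> w; apply: PCET_le1.
  by apply: ereal_inf_lbound; exists s.
(* If all codes stayed below [1 - e n - 1 / (n + 1)], so would the mean; the extra term makes this
   strictly contradict a mean of at least [1 - e n]. *)
exists (fun n => e n + n.+1%:R^-1); split=> //.
- move=> n s ds; apply: contrapT => hno.
  have hlt w : PCET (C n w) (Nns N s) <= 1 - (e n + n.+1%:R^-1).
    rewrite leNgt; apply/negP => hw; apply: hno; exists (C n w); split=> //.
    exact: ltW.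
  have := le1 n s _ ds hlt; apply/negP; rewrite -ltNge.
  apply: (@lt_le_trans _ _ (1 - e n)%:E).
    by rewrite lte_fin ltrD2l ltrN2 ltrDl invr_gt0 ltr0n.
  by rewrite -eE; apply: ereal_inf_lbound; exists s.
- by apply: ev0D => //; apply: ev0_invS.
- by move=> n; rewrite addr_ge0 ?invr_ge0 ?ler0n.
Qed.

Lemma Ad_sub_Ar : Ad_CET N `<=` Ar_CET N.
Proof.
move=> r [r1 r2 [M1 [M2 [C [cC h1 h2 cv]]]]]; split=> //.
exists M1, M2, (fun=> _), (fun=> unit), (fun=> \d_tt), (fun n _ => C n); split=> //.
rewrite (_ : (fun n => ereal_inf _) = (fun n => ereal_inf
  [set (PCET (C n) (Nns N s))%:E | s in [set s | density s]])) //.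
apply/funext => n; congr ereal_inf.
by apply/seteqP; split=> _ [s ds <-]; exists s => //; rewrite prob_integral_cst.
Qed.
End regions.

(** * Replacement maps and the code with a single message *)

Section replacement.
Variables (I J : finType) (A : op J).

Definition trrep : lmap I J := fun X => \tr X *: A.

Lemma trrep_lin : is_lin trrep.
Proof. by move=> a X Y; rewrite /trrep tr_linf scalerDl scalerA. Qed.

Lemma trrep_CP : psd A -> CP trrep.
Proof.
move=> /psd_opgram[h hE] k X /psd_opgram[g gE].
apply: (opgram_psd (g := fun x (u : (I * ('I_k * I)) * J) =>
   g (x.1, u.1.1) u.1.2 * h x.2 u.2)) => -[a p] [b q].
rewrite opE_mkop /= /trrep opEZ tr_op hE.
have -> (F : (I * ('I_k * I)) * J -> CC) :
    \sum_u F u = \sum_i \sum_s \sum_t F ((i, s), t).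
  by rewrite pair_bigA pair_bigA; apply: eq_bigr => -[[]].
rewrite mulr_suml; apply: eq_bigr => i _; rewrite opE_mkop gE mulr_suml.
apply: eq_bigr => s _; rewrite mulr_sumr; apply: eq_bigr => t _ /=.
by rewrite conjcM; ring.
Qed.
End replacement.

Section trivial_code.
Variables (dA dJ dB : nat).
Variable N : lmap ('I_dA * 'I_dJ)%type 'I_dB.
Hypotheses (cN : channel N) (dA0 : (0 < dA)%N).

(** With one message and a one-dimensional space nothing has to be transmitted: encoder and decoder
    discard their inputs and prepare fixed states. *)
Lemma good_trivial n : good N n 1 1 0.
Proof.
have [pa ta] := density_eunit ([ffun=> Ordinal dA0] : {ffun 'I_n -> 'I_dA}).
set A := eunit _ _ in pa ta.
have [pe te] := density_eunit (inl ord0 : 'I_1 + 'I_0).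
set E := eunit _ _ in pe te.
pose C := @code0 dA dB n 1 1 (fun _ => @trrep _ _ A) (fun _ => @trrep _ _ E).
have cC : is_code C.
  apply: is_codeP => //=.
  - move=> _; split; [exact: trrep_lin|exact: trrep_CP|].
    by move=> X; rewrite /trrep linearZ /= ta mulr1.
  - by move=> _; apply: trrep_lin.
  - by move=> _; apply: trrep_CP.
  by move=> X; rewrite big_ord1 /trrep linearZ /= te mulr1.
exists C; split=> // s ds; rewrite (PCET_geP cN) // subr0 /succ expr1n invr1 !mul1r.
rewrite big_ord1 /cetq /qsum !big_ord1 /= {1}/trrep opEZ tr_Nns // {1}/trrep.
have [_ ->] := ds; rewrite linearZ /= ta opE_eunit !eqxx !mulr1 mul1r.
by have [_ ->] := density_eunit (ord0 : 'I_1).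
Qed.
End trivial_code.

(** * Block lengths and rates *)

(** The root of [n - 1] rather than of [n], so that at least one use remains after the prefix
    whenever [n >= 1]. *)
Definition preflen (n : nat) : nat := PeanoNat.Nat.sqrt n.-1.

Lemma preflen_bounds n :
  (preflen n * preflen n <= n.-1 /\ n.-1 < (preflen n).+1 * (preflen n).+1)%N.
Proof. by have := PeanoNat.Nat.sqrt_spec n.-1 (PeanoNat.Nat.le_0_l _); rewrite -/(preflen n); lia. Qed.

Lemma preflen_le n : (2 * preflen n <= n)%N.
Proof. by have := preflen_bounds n; nia. Qed.

Lemma preflen_infty m : exists n0, forall n, (n0 <= n)%N -> (m <= preflen n)%N.
Proof.
exists (m * m).+1 => n nn; have [_ h] := preflen_bounds n.
rewrite leqNgt; apply/negP => hm.
by have := leq_mul hm hm; lia.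
Qed.

Lemma sub_preflen_infty m : exists n0, forall n, (n0 <= n)%N -> (m <= n - preflen n)%N.
Proof. by exists (2 * m)%N => n nn; have := preflen_le n; lia. Qed.

(** [n <= (l + 1)^2] for [l = preflen n], while [K l] grows exponentially in [l]. *)
Lemma ev0_preflen (R : realType) (K : nat -> nat) (c : R) : 0 < c ->
  (forall l, (0 < K l)%N) ->
  (exists n0, forall l, (n0 <= l)%N -> c * l%:R <= ln (K l)%:R) ->
  ev0 (fun n => (4 * (n - preflen n))%:R / (K (preflen n))%:R : R).
Proof.
move=> c0 K0 [n0 hn].
have h : ev0 (fun l => (4 * (l.+1 * l.+1))%:R / (K l)%:R : R).
  (* [exp (c l) = exp (c l / 3)^3 >= (d (l + 1))^3], one power above the square in the numerator;
     the minimum with 1 covers the constant term of [1 + c l / 3]. *)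
  pose d := Num.min 1 (c / 3).
  have d0 : 0 < d by rewrite lt_min ltr01 divr_gt0.
  apply: (@ev0_le _ (fun l => 4 / d ^+ 3 * l.+1%:R^-1)); last exact/ev0Ml/ev0_invS.
  exists n0 => l /hn hl.
  have Kl : 0 < (K l)%:R :> R by rewrite ltr0n.
  have l0 : 0 < l.+1%:R :> R by rewrite ltr0n.
  rewrite divr_ge0 ?ler0n //=.
  have KE : (d * l.+1%:R) ^+ 3 <= (K l)%:R.
    rewrite -[leRHS]lnK ?posrE //.
    apply: le_trans (_ : expR (c * l%:R) <= _); last by rewrite ler_expR.
    have -> : c * l%:R = 3%:R * (c / 3 * l%:R) by field.
    rewrite expRM_natl lerXn2r ?nnegrE ?expR_ge0 ?mulr_ge0 ?ler0n ?(ltW d0) //.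
    apply: le_trans (expR_ge1Dx _).
    rewrite -natr1 mulrDr mulr1 addrC lerD //; first by rewrite ge_min lexx.
    by rewrite ler_wpM2r ?ler0n // ge_min lexx orbT.
  rewrite ler_pdivrMr //.
  apply: le_trans (_ : 4 / d ^+ 3 * l.+1%:R^-1 * (d * l.+1%:R) ^+ 3 <= _); last first.
    by rewrite ler_wpM2l // mulr_ge0 ?divr_ge0 ?invr_ge0 ?exprn_ge0 ?ler0n // ltW.
  rewrite !natrM le_eqVlt; apply/orP; left; apply/eqP.
  by field; rewrite !gt_eqF.
apply: (@ev0_le _ (fun n => (4 * ((preflen n).+1 * (preflen n).+1))%:R / (K (preflen n))%:R)).
  exists 0 => n _; rewrite divr_ge0 ?ler0n //= ler_wpM2r ?invr_ge0 ?ler0n // ler_nat.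
  by have := preflen_bounds n; lia.
exact: (ev0_comp preflen_infty h).
Qed.

(** The prefix takes about the square root of the [n] uses. For [x < y < r] and [q = preflen n], the
    bound [x n <= y (n - q)] follows from [y <= (y - x) q] and [q^2 <= n]. *)
Lemma rate_preflen (M : nat -> nat) (r : RR) : (forall n, (0 < M n)%N) ->
  rate_ge M r -> rate_ge (fun n => M (n - preflen n)%N) r.
Proof.
move=> M0 /rate_geP hM; apply/rate_geP => x xr.
have ln2 : 0 < ln 2 :> RR by rewrite ln_gt0 // ltr1n.
have lnM n : 0 <= ln (M n)%:R :> RR by rewrite ln_ge0 // ler1n.
have [x0|x0] := ltP x 0.
  exists 0 => n _; apply: le_trans (ltW x0) _.
  by rewrite divr_ge0 // mulr_ge0 ?ler0n // ltW.
pose y := (x + r) / 2.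
have xy : x < y by rewrite ltr_pdivlMr // mulr_natr mulr2n ltrD2l.
have yr : y < r by rewrite ltr_pdivrMr // mulr_natr mulr2n ltrD2r.
have [n1 hn1] := hM y yr.
have [n2 hn2] := preflen_infty (Num.truncn (y / (y - x))).+1.
have [n3 hn3] := sub_preflen_infty (maxn n1 1).
exists (maxn n2 n3) => n; rewrite geq_max => /andP[/hn2 nq /hn3].
rewrite geq_max => /andP[nn1 nn0].
have := hn1 _ nn1; set q := preflen n in nq nn1 nn0 *; set m := (n - q)%N in nn1 nn0 *.
have n0 : (0 < n)%N by rewrite /m in nn0; lia.
rewrite !ler_pdivlMr ?mulr_gt0 ?ltr0n // => hy.
apply: le_trans hy; rewrite !mulrA ler_wpM2r ?(ltW ln2) //.
have qn : (q <= n)%N by have := preflen_le n; rewrite -/q; lia.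
rewrite /m natrB // mulrBr lerBrDr -lerBrDl -mulrBl.
have yx : 0 < y - x by rewrite subr_gt0.
have hq : y <= (y - x) * q%:R.
  rewrite mulrC -ler_pdivrMr //; apply: le_trans (ltW (truncnS_gt _)) _.
  by rewrite ler_nat.
apply: le_trans (_ : (y - x) * q%:R * q%:R <= _); first by rewrite ler_wpM2r ?ler0n.
rewrite -mulrA ler_wpM2l ?(ltW yx) // -natrM ler_nat.
by have := preflen_bounds n; rewrite -/q; lia.
Qed.

Lemma rate_growth (M : nat -> nat) (r : RR) : (forall n, (0 < M n)%N) -> 0 < r ->
  rate_ge M r -> exists c : RR, 0 < c /\
    exists n0, forall n, (n0 <= n)%N -> c * n%:R <= ln (M n)%:R.
Proof.
move=> M0 r0 /rate_geP/(_ (r / 2)) [|n0 hn].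
  by rewrite ltr_pdivrMr // mulr_natr mulr2n ltrDl.
have ln2 : 0 < ln 2 :> RR by rewrite ln_gt0 // ltr1n.
exists (r / 2 * ln 2); split; first by rewrite !mulr_gt0 ?invr_gt0.
exists n0 => -[|n] nn; first by rewrite mulr0 ln_ge0 // ler1n.
have := hn _ nn; rewrite ler_pdivlMr ?mulr_gt0 ?ltr0n //.
by rewrite mulrA mulrAC.
Qed.

(** * The dichotomy *)

Section dichotomy.
Variables (dA dJ dB : nat).
Variable N : lmap ('I_dA * 'I_dJ)%type 'I_dB.
Hypothesis cN : channel N.

Lemma is_code_gt0 n M1 M2 (C : code dA dB n M1 M2) : is_code C ->
  (0 < M1)%N /\ (0 < M2)%N.
Proof. by case. Qed.

Lemma is_code_dA_gt0 n M1 M2 (C : code dA dB n.+1 M1 M2) : is_code C -> (0 < dA)%N.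
Proof.
move=> [M10 M20 cP _ _]; have [_ pP tP] := cP (Ordinal M10).
have [pe te] := density_eunit (Ordinal M20).
have /density0 : density (cenc C (Ordinal M10) (eunit (Ordinal M20) (Ordinal M20))).
  by split; [exact: CP_psd|rewrite tP].
by rewrite card_ffun !card_ord; case: (dA) => //; rewrite exp0n.
Qed.

(** Through the trivial code, the deterministic region contains the origin as soon as the random one
    is nonempty; a deterministic region other than [{(0, 0)}] must then contain a nonzero pair. *)
Lemma Ad_origin (r : RR * RR) : Ar_CET N r -> Ad_CET N (0, 0).
Proof.
move=> /(Ar_elim cN)[dJ0 _ _ [M1 [M2 [e [hg _ _ _ _]]]]].
(* Length one, because codes of length zero exist even for [dA = 0]. *)
have [s ds] := ffun_density 1 dJ0; have [C [cC _]] := hg 1%N s ds.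
have dA0 := is_code_dA_gt0 cC.
have rate0 : rate_ge (fun=> 1%N) 0.
  apply/rate_geP => x x0; exists 0 => n _.
  by rewrite mulr1n ln1 mul0r ltW.
apply: (@Ad_intro _ _ _ _ cN (0, 0) (fun=> 1%N) (fun=> 1%N) (fun=> 0)) => //=.
- by move=> n; apply: good_trivial.
by move=> d d0; exists 0 => n _; rewrite normr0.
Qed.

Lemma Ar_sub_Ad (r r' : RR * RR) : Ad_CET N r -> r <> (0, 0) ->
  Ar_CET N r' -> Ad_CET N r'.
Proof.
move=> /(Ad_elim cN)[dJ0 r1 r2 [M1' [M2' [e1 [hg he1 h1 h2]]]]] rn0.
move=> /(Ar_elim cN)[_ r1' r2' [M1 [M2 [e2 [hr he2 e20 h1' h2']]]]].
have M'0 n : (0 < M1' n)%N /\ (0 < M2' n)%N.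
  by have [C [cC _]] := hg n; exact: is_code_gt0 cC.
have codes n : exists C : code dA dB n (M1 n) (M2 n), is_code C.
  have [s ds] := ffun_density n dJ0.
  by have [C [cC _]] := hr n s ds; exists C.
have M0 n : (0 < M1 n)%N /\ (0 < M2 n)%N.
  by have [C cC] := codes n; exact: is_code_gt0 cC.
pose K n := (M1' n * M2' n)%N.
have K0 n : (0 < K n)%N by have [a b] := M'0 n; rewrite muln_gt0 a.
have [c [c0 hK]] : exists c : RR, 0 < c /\
    exists n0, forall n, (n0 <= n)%N -> c * n%:R <= ln (K n)%:R.
  (* Each of [M1'] and [M2'] is at most [K], so one positive rate suffices. *)
  have mon (L : nat -> nat) : (forall n, (0 < L n)%N /\ (L n <= K n)%N) ->
      (exists c : RR, 0 < c /\
        exists n0, forall n, (n0 <= n)%N -> c * n%:R <= ln (L n)%:R) ->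
      exists c : RR, 0 < c /\
        exists n0, forall n, (n0 <= n)%N -> c * n%:R <= ln (K n)%:R.
    move=> hL [c [c0 [n0 hn]]]; exists c; split=> //; exists n0 => n nn.
    apply: le_trans (hn n nn) _; have [L0 LK] := hL n.
    by rewrite ler_ln ?posrE ?ltr0n // ler_nat.
  have [r10|r10] := eqVneq r.1 0; last first.
    apply: (mon M1'); last apply: (@rate_growth M1' r.1) => //.
    - by move=> n; have [a b] := M'0 n; rewrite /K leq_pmulr.
    - by move=> n; have [] := M'0 n.
    - by rewrite lt_def r10.
  have [r20|r20] := eqVneq r.2 0.
    by case: rn0; case: (r) r10 r20 => /= a b -> ->.
  apply: (mon M2'); last apply: (@rate_growth M2' r.2) => //.
  - by move=> n; have [a b] := M'0 n; rewrite /K leq_pmull.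
  - by move=> n; have [] := M'0 n.
  - by rewrite lt_def r20.
(* The sum of the two lower bounds that [good_combine] asks of [a], plus a vanishing term that makes
   it positive. *)
pose a n : RR := 2 * e2 (n - preflen n)%N
  + (4 * (n - preflen n))%:R / (K (preflen n))%:R + n.+1%:R^-1.
(* At [n = 0] no use remains for the second code, and the trivial error bound 1 is taken. *)
pose e n : RR := if n is 0 then 1 else e1 (preflen n) + expR 1 * dJ%:R * a n.
apply: (@Ad_intro _ _ _ _ cN r' (fun n => M1 (n - preflen n)%N)
  (fun n => M2 (n - preflen n)%N) e) => //.
- case=> [|n].
    have [C cC] := codes 0; exists C; split=> // s ds.
    by rewrite /e subrr; apply: PCET_ge0.
  have qn := preflen_le n.+1.
  have e0 : 0 <= e2 (n.+1 - preflen n.+1)%N by [].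
  have f0 : 0 <= (4 * (n.+1 - preflen n.+1))%:R / (K (preflen n.+1))%:R :> RR.
    by rewrite divr_ge0 ?ler0n.
  have i0 : 0 < n.+2%:R^-1 :> RR by rewrite invr_gt0 ltr0n.
  have a0 : 0 < a n.+1 by rewrite /a ltr_wpDl // addr_ge0 // mulr_ge0.
  have := @good_combine _ _ _ N cN dJ0 (preflen n.+1) (n.+1 - preflen n.+1)%N
    _ _ _ _ (e1 (preflen n.+1)) (e2 (n.+1 - preflen n.+1)%N) (a n.+1) _ e0 a0 _ _
    (hg _) (hr _).
  rewrite subnKC; last by lia.
  apply.
  + by lia.
  + by rewrite /a -addrA lerDl addr_ge0 // ltW.
  + rewrite -/(K (preflen n.+1)) -ler_pdivrMr ?ltr0n // /a -addrA addrCA lerDl.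
    by rewrite addr_ge0 ?mulr_ge0 // ltW.
- apply: (@ev0_eq _ (fun n => e1 (preflen n) + expR 1 * dJ%:R * a n)).
    by exists 1%N => -[].
  apply: ev0D; first exact: (ev0_comp preflen_infty he1).
  apply/ev0Ml/ev0D; last exact: ev0_invS.
  apply: ev0D; last exact: (ev0_preflen c0 K0 hK).
  exact/ev0Ml/(ev0_comp sub_preflen_infty he2).
- by apply: rate_preflen => // n; have [] := M0 n.
- by apply: rate_preflen => // n; have [] := M0 n.
Qed.
End dichotomy.

Theorem mainTheorem18 (dA dJ dB : nat)
  (N : lmap ('I_dA * 'I_dJ)%type 'I_dB) :
  channel N ->
  Ad_CET N = [set ((0 : RR), (0 : RR))] \/ Ad_CET N = Ar_CET N.
Proof.
move=> cN; have [|Ad0] := pselect (Ad_CET N = [set ((0 : RR), (0 : RR))]); first by left.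
right; apply/seteqP; split; first exact: Ad_sub_Ar.
move=> r' Ar'; have Ad00 := Ad_origin cN Ar'.
have [r [Adr rn0]] : exists r, Ad_CET N r /\ r <> (0, 0).
  apply: contrapT => h; apply: Ad0; apply/seteqP; split=> r; last by move=> ->.
  by move=> Adr; apply: contrapT => rn0; apply: h; exists r.
exact: Ar_sub_Ad Adr rn0 Ar'.
Qed.
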